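(* Let $\alpha\in U$ and suppose assumptions (A2) and (A3) of the context hold. Given $f\in\mathbb{C}_G(\mathbb{R}^J)$, suppose the solution $(h,g)$ to the extended Skorokhod problem (ESP) for $f$ satisfies the boundary jitter property. Let $\{f_\ell\}_{\ell\in\mathbb{N}}$ be a sequence in $\mathbb{D}_G(\mathbb{R}^J)$ such that $f_\ell$ converges to $f$ in $\mathbb{D}(\mathbb{R}^J)$ as $\ell\to\infty$, and for each $\ell$ let $(h_\ell,g_\ell)$ denote the solution to the ESP for $f_\ell$. Suppose $\psi\in\mathbb{C}(\mathbb{R}^J)$ satisfies $\psi(0)\in\mathbb{H}_{h(0)}$ and $\{\psi_\ell\}_{\ell\in\mathbb{N}}$ is a sequence in $\mathbb{D}(\mathbb{R}^J)$ such that $\psi_\ell$ converges to $\psi$ in $\mathbb{D}(\mathbb{R}^J)$ as $\ell\to\infty$. Then $\Lambda^\alpha_{h_\ell}(\psi_\ell)$ converges to $\Lambda^\alpha_h(\psi)$ in $\mathbb{D}(\mathbb{R}^J)$ as $\ell\to\infty$. (It is understood that the derivative-map values $\Lambda^\alpha_h(\psi)$ and $\Lambda^\alpha_{h_\ell}(\psi_\ell)$ are defined, i.e. that the corresponding derivative problems have unique solutions.)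
   Context: Let $J,N,M\in\mathbb{N}$, $U\subseteq\mathbb{R}^M$ open, $G=\bigcap_{i=1}^N\{x\in\mathbb{R}^J:\langle x,n_i\rangle\ge c_i\}$ with unit vectors $n_i$ and $c_i\in\mathbb{R}$, $\mathcal{I}=\{1,\dots,N\}$, $F_i=\{x\in\partial G:\langle x,n_i\rangle=c_i\}$, and $\mathcal{I}(x)=\{i:x\in F_i\}$ for $x\in G$. For $i\in\mathcal{I}$, $d_i:U\to\mathbb{R}^J$ is continuously differentiable with $\langle d_i(\alpha),n_i\rangle=1$. Put $d(\alpha,x)=\mathrm{cone}(\{d_i(\alpha):i\in\mathcal{I}(x)\})$ (convex cone generated; $\mathrm{cone}(\emptyset)=\mathrm{span}(\emptyset)=\{0\}$), $\mathbb{H}_x=\bigcap_{i\in\mathcal{I}(x)}\{y\in\mathbb{R}^J:\langle y,n_i\rangle=0\}$ ($=\mathbb{R}^J$ if $\mathcal{I}(x)=\emptyset$), and $\mathcal{N}=\{x\in\partial G:|\mathcal{I}(x)|\ge2\}$. $\mathbb{D}(E)$: right-continuous functions $[0,\infty)\to E$ with finite left limits, with the Skorokhod $J_1$-topology; $\mathbb{C}(E)$: the continuous ones. $\mathbb{D}_G(\mathbb{R}^J)$, $\mathbb{C}_G(\mathbb{R}^J)$: those $f$ with $f(0)\in G$. (A2) For each $\alpha\in U$ there are $\delta(\alpha)>0$ and a compact, convex, symmetric set $B^\alpha\subset\mathbb{R}^J$ with $0$ in its interior such that for each $i\in\mathcal{I}$: if $z\in\partial B^\alpha$ and $|\langle z,n_i\rangle|<\delta(\alpha)$,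 then $\langle\nu,d_i(\alpha)\rangle=0$ for every inward unit normal $\nu$ to $B^\alpha$ at $z$ (i.e. $|\nu|=1$ and $\langle\nu,y-z\rangle\ge0$ for all $y\in B^\alpha$). (A3) For each $\alpha\in U$ there is a map $\pi^\alpha:\mathbb{R}^J\to G$ with $\pi^\alpha(x)=x$ for $x\in G$ and $\pi^\alpha(x)-x\in d(\alpha,\pi^\alpha(x))$ for $x\notin G$. ESP (for fixed $\alpha$): given $f\in\mathbb{D}_G(\mathbb{R}^J)$, $(h,g)\in\mathbb{D}(\mathbb{R}^J)\times\mathbb{D}(\mathbb{R}^J)$ solves the ESP for $f$ if $h(0)=f(0)$ and: (1) $h=f+g$; (2) $h(t)\in G$ for all $t\ge0$; (3) $g(t)-g(s)\in\mathrm{cone}[\cup_{u\in(s,t]}d(\alpha,h(u))]$ for all $0\le s<t$; (4) $g(t)-g(t-)\in\mathrm{cone}[d(\alpha,h(t))]$ for all $t>0$. It is known that under (A2), (A3) there is a unique solution for every $f\in\mathbb{D}_G(\mathbb{R}^J)$. Derivative problem: let $(h,g)$ solve the ESP for some $f\in\mathbb{D}_G(\mathbb{R}^J)$ and let $\psi\in\mathbb{D}(\mathbb{R}^J)$. $(\phi,\eta)\in\mathbb{D}(\mathbb{R}^J)^2$ solves the derivative problem along $h$ for $\psi$ if $\eta(0)\in\mathrm{span}[d(\alpha,h(0))]$ and: (1) $\phi=\psi+\eta$; (2) $\phi(t)\in\mathbb{H}_{h(t)}$ for all $t\ge0$; (3) $\eta(t)-\eta(s)\in\mathrm{span}[\cup_{u\in(s,t]}d(\alpha,h(u))]$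 for all $0\le s<t$; (4) $\eta(t)-\eta(t-)\in\mathrm{span}[d(\alpha,h(t))]$ for all $t>0$. If there is a unique solution, write $\phi=\Lambda_h^\alpha(\psi)$ (the derivative map). Boundary jitter property of $(h,g)\in\mathbb{C}(G)\times\mathbb{C}(\mathbb{R}^J)$: (i) if $h(t)\in\partial G$ for some $t_1<t<t_2$ ($t\geq 0$), then $g$ is nonconstant on $(t_1\vee0,t_2)$; (ii) $\int_0^\infty1_{\partial G}(h(s))ds=0$; (iii) if $h(t)\in\mathcal{N}$ for some $t>0$, then for each $i\in\mathcal{I}(h(t))$ and all $\delta\in(0,t)$ there is $s\in(t-\delta,t)$ with $\mathcal{I}(h(s))=\{i\}$; (iv) if $h(0)\in\mathcal{N}$, then for each $i\in\mathcal{I}(h(0))$ and all $\delta>0$ there is $s\in(0,\delta)$ with $\mathcal{I}(h(s))=\{i\}$. *)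

(* Defs.v *)
From HB Require Import structures.
From mathcomp Require Import all_boot all_order all_algebra.
From mathcomp Require Import all_classical all_reals all_analysis.

Set Implicit Arguments.
Unset Strict Implicit.
Unset Printing Implicit Defensive.

Import Order.TTheory GRing.Theory Num.Theory.
Import numFieldNormedType.Exports.

Local Open Scope classical_set_scope.
Local Open Scope ring_scope.

Definition boundary (T : topologicalType) (A : set T) : set T :=
  closure A `\` interior A.

(* The library's norm on ['rV[R]_J] is the maximum norm; it is used below only
   through the topology (and uniformity) that it shares with the Euclidean one.
   Unit vectors are unit for [enorm]. *)
Section Euclidean.
Variables (R : realType) (J : nat).
Implicit Types (x y : 'rV[R]_J) (S : set 'rV[R]_J).

Definition dot x y : R := \sum_(j < J) x ord0 j * y ord0 j.

Definition enorm x : R := Num.sqrt (dot x x).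

(* The empty combination [m = 0] makes [conic_hull set0] and [linear_span set0]
   equal to [[set 0]]. *)
Definition conic_hull S : set 'rV[R]_J :=
  [set x | exists (m : nat) (r : 'I_m -> R) (v : 'I_m -> 'rV[R]_J),
     (forall k, 0 <= r k /\ S (v k)) /\ x = \sum_(k < m) r k *: v k].

Definition linear_span S : set 'rV[R]_J :=
  [set x | exists (m : nat) (r : 'I_m -> R) (v : 'I_m -> 'rV[R]_J),
     (forall k, S (v k)) /\ x = \sum_(k < m) r k *: v k].

End Euclidean.

Definition C1_on (R : realType) (M J : nat) (U : set 'rV[R]_M)
    (f : 'rV[R]_M -> 'rV[R]_J) : Prop :=
  forall a, U a -> differentiable f a /\ {for a, continuous (jacobian f)}.

(* A path on [0, oo) is a function on the whole of R of which only the values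
   at times t >= 0 are ever used; in particular equality of paths is equality
   on [0, oo). *)
Section Paths.
Variables (R : realType) (J : nat).
Implicit Types (f g : R -> 'rV[R]_J) (s t : R).

Definition eq_path f g : Prop := forall t, 0 <= t -> f t = g t.

Definition left_limit f (t : R) : 'rV[R]_J := lim (f u @[u --> t^'-]).

Definition cadlag f : Prop :=
  (forall t, 0 <= t -> f u @[u --> t^'+] --> f t) /\
  (forall t, 0 < t -> cvg (f u @[u --> t^'-])).

Definition cpath f : Prop :=
  {within `[0%R, +oo[%classic, continuous f}.

(* Increasing bijections of [0, oo); they are automatically continuous and fix
   0. *)
Definition time_change (lam : R -> R) : Prop :=
  set_bij `[0%R, +oo[%classic `[0%R, +oo[%classic lam /\
  (forall s t, 0 <= s -> s < t -> lam s < lam t).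

(* Convergence of a sequence of cadlag paths in the Skorokhod J1-topology of
   D(R^J) over [0, oo) (Skorokhod; Jacod-Shiryaev, VI.1.14; Ethier-Kurtz,
   III.5.3). That topology is metrizable, hence given by its convergent
   sequences. *)
Definition J1_cvg (f_ : nat -> R -> 'rV[R]_J) f : Prop :=
  exists lam_ : nat -> R -> R,
    [/\ forall l, time_change (lam_ l),
        {uniform `[0%R, +oo[%classic, lam_ @ \oo --> (fun t : R => t)} &
        forall T : R, {uniform `[0%R, T]%classic,
          (fun l t => f_ l (lam_ l t)) @ \oo --> f}].

End Paths.

Section Polyhedron.
Variables (R : realType) (J N : nat).
Variables (n : 'I_N -> 'rV[R]_J) (c : 'I_N -> R).
Implicit Types (x : 'rV[R]_J) (s t delta : R).

Definition polyhedron : set 'rV[R]_J :=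
  \bigcap_(i in [set: 'I_N]) [set x | c i <= dot x (n i)].

Definition face (i : 'I_N) : set 'rV[R]_J :=
  [set x | boundary polyhedron x /\ dot x (n i) = c i].

Definition active x : set 'I_N := [set i | face i x].

Definition active_hyperplanes x : set 'rV[R]_J :=
  \bigcap_(i in active x) [set y | dot y (n i) = 0].

(* [`I_2 #<= A] says that A has at least two elements. *)
Definition nonsmooth : set 'rV[R]_J :=
  [set x | boundary polyhedron x /\ (`I_2 #<= active x)%card].

(* The property is defined for continuous pairs (h, g) with h in the polyhedron;
   the first block records this domain. *)
Definition boundary_jitter (h g : R -> 'rV[R]_J) : Prop :=
  [/\ cpath h, forall t, 0 <= t -> polyhedron (h t)
    & cpath g] /\
  [/\ forall t, 0 <= t -> boundary polyhedron (h t) ->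
        forall t1 t2, t1 < t < t2 ->
        exists s s', [/\ Num.max t1 0 < s < t2, Num.max t1 0 < s' < t2
                       & g s <> g s'],
      (\int[lebesgue_measure]_(s in `[0%R, +oo[%classic)
         (\1_(boundary polyhedron) (h s))%:E = 0)%E,
      forall t, 0 < t -> nonsmooth (h t) ->
        forall i, active (h t) i -> forall delta, 0 < delta < t ->
        exists2 s : R, t - delta < s < t & active (h s) = [set i]
    & nonsmooth (h 0) ->
        forall i, active (h 0) i -> forall delta, 0 < delta ->
        exists2 s : R, 0 < s < delta & active (h s) = [set i]].

(* The reflection directions [d i] at a fixed parameter value. *)
Section Reflection.
Variable d : 'I_N -> 'rV[R]_J.

Definition dcone x : set 'rV[R]_J := conic_hull (d @` active x).

Definition inward_unit_normal (B : set 'rV[R]_J) (z nu : 'rV[R]_J) : Prop :=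
  enorm nu = 1 /\ forall y, B y -> 0 <= dot nu (y - z).

Definition assumption_A2 : Prop :=
  exists (delta : R) (B : set 'rV[R]_J),
    [/\ 0 < delta,
        [/\ compact B, convex_set B, forall x, B x -> B (- x)
          & interior B 0]
      & forall i z, boundary B z -> `|dot z (n i)| < delta ->
          forall nu, inward_unit_normal B z nu -> dot nu (d i) = 0].

Definition assumption_A3 : Prop :=
  exists proj : 'rV[R]_J -> 'rV[R]_J,
    [/\ forall x, polyhedron (proj x),
        forall x, polyhedron x -> proj x = x
      & forall x, ~ polyhedron x -> dcone (proj x) (proj x - x)].

Definition solves_ESP (f h g : R -> 'rV[R]_J) : Prop :=
  [/\ cadlag h, cadlag g & h 0 = f 0] /\
  [/\ forall t, 0 <= t -> h t = f t + g t,
      forall t, 0 <= t -> polyhedron (h t),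
      forall s t, 0 <= s -> s < t ->
        conic_hull (\bigcup_(u in `]s, t]%classic) dcone (h u)) (g t - g s)
    & forall t, 0 < t -> conic_hull (dcone (h t)) (g t - left_limit g t)].

Definition solves_derivative_problem
    (h psi phi eta : R -> 'rV[R]_J) : Prop :=
  [/\ cadlag phi, cadlag eta & linear_span (dcone (h 0)) (eta 0)] /\
  [/\ forall t, 0 <= t -> phi t = psi t + eta t,
      forall t, 0 <= t -> active_hyperplanes (h t) (phi t),
      forall s t, 0 <= s -> s < t ->
        linear_span (\bigcup_(u in `]s, t]%classic) dcone (h u)) (eta t - eta s)
    & forall t, 0 < t -> linear_span (dcone (h t)) (eta t - left_limit eta t)].

(* [derivative_map h psi phi]: the derivative problem along [h] for [psi] has a
   unique solution, and [phi] is its first component. *)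
Definition derivative_map (h psi phi : R -> 'rV[R]_J) : Prop :=
  exists2 eta, solves_derivative_problem h psi phi eta &
    forall phi' eta', solves_derivative_problem h psi phi' eta' ->
      eq_path phi' phi /\ eq_path eta' eta.

End Reflection.
End Polyhedron.

(* Main.v *)
Require Import Defs.
From mathcomp Require Import all_boot all_order all_algebra.
From mathcomp Require Import all_classical all_reals all_analysis.
From mathcomp Require Import ring lra.
Set Implicit Arguments.
Unset Strict Implicit.
Unset Printing Implicit Defensive.
Import Order.TTheory GRing.Theory Num.Theory.
Import numFieldNormedType.Exports.
Local Open Scope classical_set_scope.
Local Open Scope ring_scope.

(* Both the reflection map and the derivative map are controlled by the gauge
   of the set of (A2): a functional supporting the gauge ball does not increase
   along admissible pushes, so the difference of two constraining terms never
   leaves a small gauge ball. For the reflection map this gives locally uniform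
   convergence of [h_l] to [h]. For the derivative map along [h_l], the
   competitor of [eta_l] is a finite sum of jumps: [0, T] is cut at times at
   which [h] is in the interior, and on each piece the increment of [eta], a
   combination of directions [d i] of faces visited by [h], is replaced by
   jumps along the same [d i] at times at which [h_l] visits face [i]. Such
   visits exist by the jitter property. The increments are small, and need no
   time change, except where [phi] jumps; there [h] reaches a single face from
   the interior, and the time change sends the jump time to the first visit of
   [h_l] to that face. *)

(** The obstacle is that [h] and [h_l] visit a face at different times, whereas the gauge comparison
    needs both paths to move at each instant along directions of faces active at that instant. Hence
    [eta] itself is no competitor along [h_l]. Nothing controls the variation of [eta] either, so
    its motion cannot be transported instant by instant; only its net increment over a piece is
    moved. The jumps of a piece add up exactly to that increment, so the next piece starts again
    from the true value of [eta]. Errors therefore do not accumulate, and the final bound is a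
    constant times the oscillation allowed on one piece, whatever the number of pieces. The constant
    exists because increments have coefficients along the [d i] bounded by their norm, uniformly
    over the finitely many sets of faces. Pieces end at interior times so that every visit of [h]
    inside a piece has room on both sides for the nearby visit of [h_l]. *)

(** * Euclidean product against the maximum norm *)

Section Dot.
Variables (R : realType) (J : nat).
Implicit Types (x y z L : 'rV[R]_J) (a : R).

Lemma dotC x y : dot x y = dot y x.
Proof. by apply: eq_bigr => j _; rewrite mulrC. Qed.

Lemma dotDl x y z : dot (x + y) z = dot x z + dot y z.
Proof. by rewrite -big_split; apply: eq_bigr => j _; rewrite mxE mulrDl. Qed.

Lemma dotZl a x z : dot (a *: x) z = a * dot x z.
Proof. by rewrite mulr_sumr; apply: eq_bigr => j _; rewrite mxE mulrA. Qed.

Lemma dotNl x z : dot (- x) z = - dot x z.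
Proof. by rewrite -scaleN1r dotZl mulN1r. Qed.

Lemma dotBl x y z : dot (x - y) z = dot x z - dot y z.
Proof. by rewrite dotDl dotNl. Qed.

Lemma dot0l z : dot 0 z = 0.
Proof. by rewrite -[X in dot X _](scale0r z) dotZl mul0r. Qed.

Lemma dotDr x y z : dot z (x + y) = dot z x + dot z y.
Proof. by rewrite !(dotC z) dotDl. Qed.

Lemma dotZr a x z : dot z (a *: x) = a * dot z x.
Proof. by rewrite !(dotC z) dotZl. Qed.

Lemma dotNr x z : dot z (- x) = - dot z x.
Proof. by rewrite !(dotC z) dotNl. Qed.

Lemma dotBr x y z : dot z (x - y) = dot z x - dot z y.
Proof. by rewrite !(dotC z) dotBl. Qed.

Lemma dot0r z : dot z 0 = 0.
Proof. by rewrite dotC dot0l. Qed.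

Lemma dotDZ x y a : dot (x + a *: y) (x + a *: y) =
  dot x x + 2 * a * dot x y + a ^+ 2 * dot y y.
Proof. by rewrite dotDl !dotDr !dotZl !dotZr (dotC y x); ring. Qed.

Lemma dot_sumr (I : Type) (s : seq I) (P : pred I) (F : I -> 'rV[R]_J) z :
  dot z (\sum_(i <- s | P i) F i) = \sum_(i <- s | P i) dot z (F i).
Proof.
by elim/big_rec2: _ => [|i a b _ <-]; rewrite ?dot0r// dotDr.
Qed.

Lemma coord_le_norm x j : `|x ord0 j| <= `|x|.
Proof.
rewrite -[leRHS]/(mx_norm x) mx_normrE.
by apply/bigmax_geP; right => /=; exists (ord0, j).
Qed.

Lemma normr_dot_le x y : `|dot x y| <= J%:R * `|x| * `|y|.
Proof.
apply: le_trans (ler_norm_sum _ _ _) _.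
apply: (@le_trans _ _ (\sum_(j < J) `|x| * `|y|)).
  by apply: ler_sum => j _; rewrite normrM ler_pM// coord_le_norm.
by rewrite sumr_const card_ord -mulrA mulr_natl.
Qed.

Lemma norm_sqr_le_dot x : `|x| ^+ 2 <= dot x x.
Proof.
have [->|x0] := eqVneq x 0; first by rewrite normr0 expr0n dot0l.
have : mx_norm x != 0 by rewrite -[mx_norm x]/`|x| normr_eq0.
move=> /mx_norm_neq0[[k j]]; rewrite ord1 -[mx_norm x]/`|x| => /= ->.
rewrite real_normK ?num_real// /dot (bigD1 j)//= -expr2 lerDl.
by apply: sumr_ge0 => i _; rewrite -expr2 sqr_ge0.
Qed.

Lemma dotxx_ge0 x : 0 <= dot x x.
Proof. by apply: sumr_ge0 => i _; rewrite -expr2 sqr_ge0. Qed.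

Lemma dotxx_gt0 x : x != 0 -> 0 < dot x x.
Proof.
by move=> x0; apply: lt_le_trans (norm_sqr_le_dot x); rewrite exprn_gt0// normr_gt0.
Qed.

Lemma enorm1_dotxx x : enorm x = 1 -> dot x x = 1.
Proof.
by move=> x1; rewrite -(sqr_sqrtr (dotxx_ge0 x)) -/(enorm x) x1 expr1n.
Qed.

Lemma enorm1_norm_le x : enorm x = 1 -> `|x| <= 1.
Proof.
move/enorm1_dotxx => x1; have := norm_sqr_le_dot x.
by rewrite x1 expr_le1.
Qed.

Lemma dot_lipschitz (y : 'rV[R]_J) x z e : `|x - z| <= e -> `|y| <= 1 ->
  `|dot x y - dot z y| <= J%:R * e.
Proof.
move=> xz y1; rewrite -dotBl; apply: le_trans (normr_dot_le _ _) _.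
rewrite -mulrA ler_wpM2l//; apply: le_trans xz.
by rewrite ler_piMr.
Qed.

Lemma dot_continuous y : continuous (fun x => dot x y).
Proof.
have k0 : 0 < J%:R * `|y| + 1 by rewrite ltr_wpDl// mulr_ge0.
move=> x A /nbhs_ballP[e /= e0 eA]; apply/nbhs_ballP.
exists (e / (J%:R * `|y| + 1)) => [/=|u]; first exact: divr_gt0.
rewrite -ball_normE /ball_/= ltr_pdivlMr// => xu.
apply: eA; rewrite -ball_normE /ball_/= -dotBl.
apply: le_lt_trans (normr_dot_le _ _) _; apply: le_lt_trans xu.
by rewrite mulrAC mulrC ler_wpM2l// lerDl.
Qed.

End Dot.

(** * Polar sets and the gauge of (A2) *)

Section Support.
Variables (R : realType) (J : nat).
Implicit Types (x y z L : 'rV[R]_J) (B : set 'rV[R]_J).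

(** First-order optimality along a segment: divide by [t] and let [t] tend to 0. *)
Lemma dot_affine_ge0 (a b : R) : 0 <= b ->
  (forall t, 0 < t -> t < 1 -> 0 <= 2 * t * a + t ^+ 2 * b) -> 0 <= a.
Proof.
move=> b0 H; rewrite leNgt; apply/negP => a0.
pose t := Num.min (2^-1) (- a / (b + 1)).
have b1 : 0 < b + 1 by lra.
have t0 : 0 < t by rewrite lt_min invr_gt0 ltr0n divr_gt0// oppr_gt0.
have t1 : t < 1 by rewrite gt_min; apply/orP; left; lra.
have tb : t * (b + 1) <= - a by rewrite -ler_pdivlMr// ge_min lexx orbT.
have := H t t0 t1.
rewrite (_ : _ + _ = t * (2 * a + t * b)); last by ring.
rewrite pmulr_rge0//; nra.
Qed.

Definition polar B : set 'rV[R]_J := [set L | forall y, B y -> dot L y <= 1].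

Lemma convex_set_segment B x y (t : R) : convex_set B -> B x -> B y ->
  0 < t -> t < 1 -> B (x + t *: (y - x)).
Proof.
move=> cB Bx By t0 t1.
have /set_mem := cB y x (Itv01 (ltW t0) (ltW t1)) (mem_set By) (mem_set Bx).
have -> : x + t *: (y - x) = t *: y + (1 - t) *: x.
  by rewrite scalerBr scalerBl scale1r addrCA.
by [].
Qed.

(** The nearest point [b] of [B] to [y] is a minimum on each segment of [B] from [b], which puts [B]
    in the half-space at [b] with normal [b - y]. *)
Lemma polar_separation B y : compact B -> convex_set B -> B 0 -> ~ B y ->
  exists2 L, polar B L & 1 < dot L y.
Proof.
move=> cptB cvxB B0 By.
have cB : {within B, continuous (fun x => dot (x - y) (x - y))}.
  apply: continuous_subspaceT => x.
  have -> : (fun x => dot (x - y) (x - y)) = 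
      \sum_(j < J) (fun x : 'rV[R]_J => (x ord0 j - y ord0 j) * (x ord0 j - y ord0 j)).
    by apply/funext => u; rewrite /dot fct_sumE; apply: eq_bigr => j _; rewrite !mxE.
  apply: (big_ind (fun f : 'rV[R]_J -> R => {for x, continuous f})).
  - exact: cst_continuous.
  - by move=> f g cf cg; exact: (continuousD cf cg).
  - move=> j _; have c1 : {for x, continuous (fun x : 'rV[R]_J => x ord0 j - y ord0 j)}.
      apply: (@continuousB _ _ _ (fun x : 'rV[R]_J => x ord0 j)) => //.
        exact: coord_continuous.
      exact: cst_continuous.
    exact: (continuousM c1 c1).
have [b /set_mem Bb bmin] := @compact_EVT_min _ _ _ B (ex_intro _ 0 B0) cptB cB.
pose nu := b - y.
have nu0 : nu != 0 by apply: contra_notN By; rewrite subr_eq0 => /eqP <-.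
have nuB x : B x -> 0 <= dot nu (x - b).
  move=> Bx; apply: (@dot_affine_ge0 _ (dot (x - b) (x - b)) (dotxx_ge0 _)) => t t0 t1.
  have := bmin _ (mem_set (convex_set_segment cvxB Bb Bx t0 t1)).
  rewrite (_ : b + _ - y = nu + t *: (x - b)); last by rewrite addrAC.
  by rewrite -/nu dotDZ -addrA lerDl.
pose s := dot nu nu; have s0 : 0 < s by exact: dotxx_gt0.
pose be := - dot nu b.
have be0 : 0 <= be by have := nuB 0 B0; rewrite sub0r dotNr.
(* The level lies halfway between [be], the maximum of [- nu] on [B], and [be + s], its value at
   [y]; it stays positive when [be = 0]. *)
have bs0 : 0 < be + s / 2 by lra.
exists ((be + s / 2)^-1 *: - nu).
  move=> x Bx; rewrite dotZl dotNl mulrC ler_pdivrMr// mul1r.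
  by have := nuB x Bx; rewrite dotBr /be; lra.
rewrite dotZl dotNl mulrC ltr_pdivlMr// mul1r.
have -> : y = b - nu by rewrite /nu opprB addrC subrK.
rewrite dotBr -/s /be; lra.
Qed.

(** A ball of radius [r] inside [B] bounds the polar by [2 / r]: test [L] on its own multiple of
    norm [r / 2]. *)
Lemma polar_compact B : interior B 0 -> compact (polar B).
Proof.
move=> B0; apply: bounded_closed_compact; last first.
  have -> : polar B = \bigcap_(y in B) [set L | dot L y <= 1] by [].
  apply: closed_bigI => y By.
  have c1 : {in ~` ((fun L : 'rV[R]_J => dot L y) @^-1` [set r : R | r <= 1]),
      continuous (fun L => dot L y)}.
    by move=> x _; exact: dot_continuous.
  exact: preimage_closed c1 (@closed_le _ 1).
move: B0 => /nbhs_ballP[r /= r0 rB].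
exists (2 / r); split; first exact: num_real.
move=> M rM L pL; apply: le_trans (ltW rM).
have [->|L0] := eqVneq L 0; first by rewrite normr0 divr_ge0// ltW.
have nL : 0 < `|L| by rewrite normr_gt0.
have : dot L ((r / 2 / `|L|) *: L) <= 1.
  apply/pL/rB; rewrite -ball_normE /ball_/= sub0r normrN normrZ ger0_norm.
    by rewrite divfK ?gt_eqF//; lra.
  by rewrite !divr_ge0// ltW.
rewrite dotZr => H.
have : r / 2 / `|L| * `|L| ^+ 2 <= 1.
  by apply: le_trans H; rewrite ler_wpM2l ?norm_sqr_le_dot// !divr_ge0// ltW.
rewrite expr2 mulrA divfK ?gt_eqF// => H2.
rewrite ler_pdivlMr//; lra.
Qed.

(* [p] is the Minkowski functional of the set [B] of (A2), written as the
   support function of the polar of [B], so that supporting functionals exist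
   by compactness; [mu z] is one at [z]. *)
Lemma A2_gauge (N : nat) (n d : 'I_N -> 'rV[R]_J)
    (hdn : forall i, dot (d i) (n i) = 1) :
  assumption_A2 n d ->
  exists (p : 'rV[R]_J -> R) (mu : 'rV[R]_J -> 'rV[R]_J) (k C : R),
    [/\ 0 < k, 0 < C, forall z, `|z| <= C * p z, forall z, p z <= C * `|z| &
     [/\ forall z, dot (mu z) z = p z,
        forall z y, dot (mu z) y <= p y,
        forall i z, 0 < p z -> dot z (n i) < k * p z -> dot (mu z) (d i) <= 0
      & forall i z, 0 < p z -> - (k * p z) < dot z (n i) ->
          0 <= dot (mu z) (d i)]].
Proof.
move=> [k [B [k0 [cptB cvxB _ intB0] A2]]].
have B0 : B 0 by exact: interior_subset.
have cptP := polar_compact intB0.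
have P0 : polar B 0 by move=> y _; rewrite dot0l.
have ex_mu z : exists L, polar B L /\ forall L', polar B L' -> dot L' z <= dot L z.
  have cf : {within polar B, continuous (fun L => dot L z)}.
    by apply: continuous_subspaceT => x; exact: dot_continuous.
  have [L /set_mem pL Lmax] := @compact_EVT_max _ _ _ (polar B) (ex_intro _ 0 P0) cptP cf.
  by exists L; split => // L' /mem_set/Lmax.
have [mu hmu] := choice ex_mu.
pose p z := dot (mu z) z.
have pmu z : polar B (mu z) by have [] := hmu z.
have pmax z L : polar B L -> dot L z <= p z by have [_] := hmu z; apply.
have /ex_strict_bound_gt0[M1 M10 HM1] := compact_bounded cptB.
have /ex_strict_bound_gt0[M2 M20 HM2] := compact_bounded cptP.
have p_gt0 z : z != 0 -> 0 < p z.
  (* Since [B] lies in the ball of radius [M1], this multiple of [z] belongs to the polar, and its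
     value at [z] is positive. *)
  move=> z0; pose t := (J%:R * `|z| * M1 + 1)^-1.
  have t0 : 0 < t.
    by rewrite invr_gt0 ltr_wpDl// !mulr_ge0// ltW.
  apply: (@lt_le_trans _ _ (dot (t *: z) z)).
    by rewrite dotZl mulr_gt0// dotxx_gt0.
  apply: pmax => y By; rewrite dotZl mulrC ler_pdivrMr ?mul1r; last first.
    by rewrite -invr_gt0.
  apply: le_trans (ler_norm _) _; apply: le_trans (normr_dot_le _ _) _.
  apply: (@le_trans _ _ (J%:R * `|z| * M1)); last by rewrite lerDl.
  by rewrite ler_wpM2l// ?mulr_ge0// ltW// HM1.
(* Bipolar argument: a point outside [B] would be separated by some [L] in the polar, but [L] is at
   most [p z] at [z]. *)
have inB z : 0 < p z -> B ((p z)^-1 *: z).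
  move=> pz; apply: contrapT => /(polar_separation cptB cvxB B0)[L pL].
  rewrite dotZr ltNge => /negP; apply.
  by rewrite mulrC ler_pdivrMr// mul1r pmax.
(* The rescaled point [z / p z] is on the boundary, since any dilation of it leaves the half-space
   where [mu z] is at most 1. Its inward normal is [- mu z], normalized. *)
have A2' i z : 0 < p z -> `|dot z (n i)| < k * p z -> dot (mu z) (d i) = 0.
  move=> pz zn.
  pose L := mu z.
  have L0 : L != 0.
    by apply: contraTneq pz => L0; rewrite /p -/L L0 dot0l ltxx.
  have e0 : 0 < enorm L by rewrite sqrtr_gt0 dotxx_gt0.
  have bd : boundary B ((p z)^-1 *: z).
    split; first by apply: subset_closure; exact: inB.
    move=> /nbhs_ballP[r /= r0 rB].
    pose w := (p z)^-1 *: z.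
    pose t := r / (`|w| + 1).
    have w1 : 0 < `|w| + 1 by rewrite ltr_wpDl.
    have t0 : 0 < t by rewrite divr_gt0.
    have : B (w + t *: w).
      apply: rB; rewrite -ball_normE /ball_/= opprD addrA subrr sub0r normrN normrZ.
      rewrite gtr0_norm// /t mulrAC ltr_pdivrMr// ltr_pM2l//; lra.
    have Lw : dot L w = 1 by rewrite dotZr -/(p z) mulVf ?gt_eqF.
    move=> /(pmu z); rewrite -/L dotDr (dotZr t) Lw; lra.
  have := A2 i _ bd _ (- (enorm L)^-1 *: L).
  rewrite dotZl normrM gtr0_norm ?invr_gt0// mulrC ltr_pdivrMr//.
  move=> /(_ zn) H.
  have : dot (- (enorm L)^-1 *: L) (d i) = 0.
    apply: H; split.
      rewrite /enorm dotZl dotZr mulrA mulrNN -invfM sqrtrM; last first.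
        by rewrite invr_ge0 mulr_ge0// ltW.
      rewrite sqrtrV; last by rewrite mulr_ge0// ltW.
      by rewrite -expr2 sqrtr_sqr ger0_norm ?ltW// -/(enorm L) mulVf ?gt_eqF.
    move=> y By; rewrite dotZl dotBr dotZr [dot L z]/(p z) mulVf ?gt_eqF//.
    rewrite mulNr -mulrN; apply: mulr_ge0; first by rewrite invr_ge0 ltW.
    by rewrite opprB subr_ge0 pmu.
  rewrite dotZl => /eqP; rewrite mulf_eq0 oppr_eq0 invr_eq0 gt_eqF//=.
  by move/eqP.
(* (A2) speaks only of a band around the hyperplane; this gives the sign outside it. Slide [z] along
   [d i] to [w] in the hyperplane. Opposite signs would make [p w > p z], but [mu w] annihilates
   [d i], so [p w] is the value of [mu w] at [z], at most [p z]. *)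
have sgn i z : 0 < p z ->
    0 <= dot z (n i) * dot (mu z) (d i).
  move=> pz; set s := dot z (n i); set m := dot (mu z) (d i).
  rewrite leNgt; apply/negP => sm.
  pose w := z - s *: d i.
  have wn : dot w (n i) = 0 by rewrite dotBl dotZl hdn mulr1 subrr.
  have pw : p z < p w.
    apply: (@lt_le_trans _ _ (dot (mu z) w)); last exact: pmax.
    by rewrite dotBr dotZr -/m -/(p z); lra.
  have pw0 : 0 < p w by exact: lt_trans pw.
  have H : dot (mu w) (d i) = 0.
    by apply: A2' => //; rewrite wn normr0 mulr_gt0.
  have : p w <= p z.
    rewrite {1}/p {2}/w dotBr dotZr H mulr0 subr0; exact: pmax.
  lra.
pose C := Num.max M1 (J%:R * M2).
exists p, mu, k, C; split => //.
- by rewrite lt_max M10.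
- move=> z; have [->|z0] := eqVneq z 0; first by rewrite /p dot0r normr0 mulr0.
  have pz := p_gt0 z z0.
  apply: (@le_trans _ _ (M1 * p z)); last first.
    by apply: ler_wpM2r; [exact: ltW|rewrite le_max lexx].
  have /ltW := HM1 _ (inB z pz).
  by rewrite normrZ gtr0_norm ?invr_gt0// mulrC ler_pdivrMr.
- move=> z; apply: (@le_trans _ _ (J%:R * M2 * `|z|)); last first.
    by rewrite ler_wpM2r// le_max lexx orbT.
  apply: le_trans (ler_norm _) _; apply: le_trans (normr_dot_le _ _) _.
  by rewrite ler_wpM2r// ler_wpM2l// ltW// HM2.
split => // [z y|i z pz|i z pz]; first exact: pmax.
- move=> zn; have kp : 0 < k * p z by rewrite mulr_gt0.
  have [h|h] := ltP (- (k * p z)) (dot z (n i)).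
    by rewrite A2'// ltr_norml h zn.
  have := sgn i z pz; rewrite nmulr_rge0//; apply: le_lt_trans h _.
  by rewrite oppr_lt0.
- move=> zn; have kp : 0 < k * p z by rewrite mulr_gt0.
  have [h|h] := ltP (dot z (n i)) (k * p z).
    by rewrite A2'// ltr_norml h zn.
  by have := sgn i z pz; rewrite pmulr_rge0//; apply: lt_le_trans kp h.
Qed.

End Support.

Section Limits.
Variables (R : realType) (V : normedModType R).
Implicit Types (f : R -> V) (l : V) (t : R).

Lemma cvg_right_dist f t l : f u @[u --> t^'+] --> l ->
  forall e, 0 < e -> exists2 r, 0 < r &
    forall u, t < u -> u < t + r -> `|f u - l| < e.
Proof.
move=> /cvgrPdist_lt fl e /fl /nbhs_ballP[r /= r0 H]; exists r => // u tu ur.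
rewrite distrC; apply: H => //=; rewrite -ball_normE /ball_/= distrC gtr0_norm; lra.
Qed.

Lemma cvg_left_dist f t l : f u @[u --> t^'-] --> l ->
  forall e, 0 < e -> exists2 r, 0 < r &
    forall u, t - r < u -> u < t -> `|f u - l| < e.
Proof.
move=> /cvgrPdist_lt fl e /fl /nbhs_ballP[r /= r0 H]; exists r => // u tu ur.
rewrite distrC; apply: H => //=; rewrite -ball_normE /ball_/= gtr0_norm; lra.
Qed.

Lemma dist_cvg_right f t l :
  (forall e, 0 < e -> exists2 r, 0 < r &
    forall u, t < u -> u < t + r -> `|f u - l| < e) ->
  f u @[u --> t^'+] --> l.
Proof.
move=> H; apply/cvgrPdist_lt => e /H[r r0 {}H].
apply/nbhs_ballP; exists r => //= u; rewrite -ball_normE /ball_/= => tu u_t.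
rewrite distrC H//; move: tu; rewrite ltr_distlC => /andP[]; lra.
Qed.

Lemma dist_cvg_left f t l :
  (forall e, 0 < e -> exists2 r, 0 < r &
    forall u, t - r < u -> u < t -> `|f u - l| < e) ->
  f u @[u --> t^'-] --> l.
Proof.
move=> H; apply/cvgrPdist_lt => e /H[r r0 {}H].
apply/nbhs_ballP; exists r => //= u; rewrite -ball_normE /ball_/= => tu u_t.
rewrite distrC H//; move: tu; rewrite ltr_distlC => /andP[]; lra.
Qed.

End Limits.

(** * The gauge estimate at the first exit *)

Section FirstExit.
Variables (R : realType) (J N : nat) (n d : 'I_N -> 'rV[R]_J).
Hypothesis n1 : forall i, `|n i| <= 1.
Variables (p : 'rV[R]_J -> R) (mu : 'rV[R]_J -> 'rV[R]_J) (k : R).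
Hypotheses (k0 : 0 < k)
  (mu_p : forall z, dot (mu z) z = p z) (mu_le : forall z y, dot (mu z) y <= p y)
  (mu_le0 : forall i z, 0 < p z -> dot z (n i) < k * p z -> dot (mu z) (d i) <= 0)
  (mu_ge0 : forall i z, 0 < p z -> - (k * p z) < dot z (n i) ->
          0 <= dot (mu z) (d i)).

Definition admissible (up down : 'I_N -> R -> Prop) (t : R) (L : 'rV[R]_J) :=
  forall i, (up i t -> dot L (d i) <= 0) /\ (down i t -> 0 <= dot L (d i)).

(* The hypotheses say, in dual form, that [z] moves at time [u] only by
   nonnegative multiples of the [d i] with [up i u] and of the [- d i] with
   [down i u]. A functional supporting the gauge ball at the first exit point
   from the level [3 e / k] does not increase along such moves. *)
Lemma gauge_bound (z : R -> 'rV[R]_J) (T e : R) (up down : 'I_N -> R -> Prop) :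
  0 < e ->
  (forall t, 0 <= t -> z u @[u --> t^'+] --> z t) ->
  (forall t, 0 < t -> t <= T -> exists2 zl : 'rV[R]_J, z u @[u --> t^'-] --> zl &
     forall L, admissible up down t L -> dot L (z t - zl) <= 0) ->
  (forall s t, 0 <= s -> s < t -> t <= T -> forall L,
     (forall u, s < u -> u <= t -> admissible up down u L) ->
     dot L (z t - z s) <= 0) ->
  (forall L, admissible up down 0 L -> dot L (z 0) <= 0) ->
  (forall i u, 0 <= u -> u <= T -> up i u -> dot (z u) (n i) <= e) ->
  (forall i u, 0 <= u -> u <= T -> down i u -> - e <= dot (z u) (n i)) ->
  forall t, 0 <= t -> t <= T -> p (z t) <= 3 * e / k.
Proof.
move=> e0 rc ll mv mv0 upe downe t1 t10 t1T; rewrite leNgt; apply/negP => pt1.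
(* Above this level the band of (A2) has half-width over [3 * e]: [e] for the constraint and [2 * e]
   for the displacement of [z] just after the exit time. *)
pose K := 3 * e / k.
have K0 : 0 < K by rewrite divr_gt0// mulr_gt0.
have kK a : K < a -> 3 * e < k * a by rewrite /K ltr_pdivrMr// (mulrC a).
pose S := [set t | [/\ 0 <= t, t <= T & K < p (z t)]].
have S1 : S t1 by [].
have infS : has_inf S by split; [exists t1|exists 0 => t []].
pose tau := inf S.
have tau0 : 0 <= tau by apply: lb_le_inf; [exists t1|move=> t []].
have tauT : tau <= T.
  by apply: le_trans t1T; apply: ge_inf => //; case: infS.
have ltau t : 0 <= t -> t < tau -> p (z t) <= K.
  move=> t0 tt; rewrite leNgt; apply/negP => pt.
  have : tau <= t by apply: ge_inf; [case: infS|split => //; lra].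
  by rewrite leNgt tt.
(* If the level is already exceeded at [tau], the excess comes from a jump there, or from the start.
   The functional at [z tau] does not increase over the jump, so it exceeds [K] at the left limit,
   against the bound before [tau]. *)
have [ptau|ptau] := ltP K (p (z tau)).
  pose L := mu (z tau).
  have pz : 0 < p (z tau) by exact: lt_trans ptau.
  have aL : admissible up down tau L.
    move=> i; split => [/upe|/downe] => /(_ tau0 tauT) H.
      by apply: mu_le0 => //; have := kK _ ptau; lra.
    by apply: mu_ge0 => //; have := kK _ ptau; lra.
  have [tau_eq|tau_gt] := eqVneq tau 0.
    by have := mv0 L; rewrite -tau_eq mu_p => /(_ aL); lra.
  have {}tau_gt : 0 < tau by rewrite lt_neqAle eq_sym tau_gt.
  have [zl zlP /(_ L aL)] := ll tau tau_gt tauT.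
  rewrite dotBr mu_p => H.
  pose g := dot L zl - K.
  have g0 : 0 < g by rewrite /g; lra.
  pose M := J%:R * `|L| + 1.
  have M0 : 0 < M by rewrite ltr_wpDl// mulr_ge0.
  have [r r0 hr] := cvg_left_dist zlP (divr_gt0 g0 M0).
  pose u := Num.max (tau - r / 2) (tau / 2).
  have u0 : 0 <= u by rewrite le_max; apply/orP; right; lra.
  have u1 : tau - r < u by rewrite lt_max; apply/orP; left; lra.
  have u2 : u < tau by rewrite gt_max; apply/andP; split; lra.
  have := hr u u1 u2; rewrite ltr_pdivlMr// => zu.
  have := ltau u u0 u2; have := mu_le (z tau) (z u); rewrite -/L => h1 h2.
  have : dot L (zl - z u) <= `|z u - zl| * M.
    apply: le_trans (ler_norm _) _; apply: le_trans (normr_dot_le _ _) _.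
    rewrite (distrC zl) mulrC; apply: ler_wpM2l => //. by rewrite /M lerDl.
  by rewrite dotBr; move: zu; rewrite /g; lra.
(* Otherwise the level is passed at times [t] arbitrarily close after [tau]. The functional is now
   taken at [z t]; right-continuity moves the normal components by at most [2 * e] on []tau, t]], so
   it is admissible on that whole interval and is compared with its value at [z tau]. *)
pose e' := e / (J%:R + 1).
have J1 : 0 < J%:R + 1 :> R by rewrite ltr_wpDl.
have e'0 : 0 < e' by rewrite divr_gt0.
have Je' : J%:R * e' <= e.
  by rewrite /e' mulrA ler_pdivrMr// mulrC (ler_wpM2l (ltW e0))// lerDl.
have [r r0 hr] := cvg_right_dist (rc tau tau0) e'0.
have [t [t0 tT pt] tr] : exists2 t, S t & t < tau + r.
  by apply: inf_adherent.
have taut : tau < t.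
  rewrite lt_neqAle; apply/andP; split; last by apply: ge_inf => //; case: infS.
  by apply/eqP => E; move: pt; rewrite -E ltNge ptau.
have zt u : tau < u -> u <= t -> `|z u - z tau| < e'.
  by move=> h1 h2; apply: hr => //; lra.
pose L := mu (z t).
have pz : 0 < p (z t) by exact: lt_trans pt.
have close u i : tau < u -> u <= t -> `|dot (z t) (n i) - dot (z u) (n i)| <= 2 * e.
  move=> h1 h2; apply: le_trans (dot_lipschitz (lexx _) (n1 i)) _.
  have -> : z t - z u = (z t - z tau) - (z u - z tau) by rewrite opprB addrA subrK.
  apply: (@le_trans _ _ (J%:R * (e' + e'))); last lra.
  rewrite ler_wpM2l//; apply: le_trans (ler_normB _ _) _.
  by rewrite lerD// ltW// zt.
have := mv tau t tau0 taut tT L.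
suff aL u : tau < u -> u <= t -> admissible up down u L.
  move=> /(_ aL); rewrite dotBr mu_p; have := mu_le (z t) (z tau).
  by rewrite -/L; move: pt; lra.
move=> h1 h2 i; have := close u i h1 h2; rewrite ler_norml => /andP[c1 c2].
have u0 : 0 <= u by lra.
have uT : u <= T by lra.
split => [/upe|/downe] => /(_ u0 uT) H.
  by apply: mu_le0 => //; have := kK _ pt; lra.
by apply: mu_ge0 => //; have := kK _ pt; lra.
Qed.

End FirstExit.

(** * Locally uniform convergence and Skorokhod convergence to a continuous path *)

Section LocallyUniform.
Variables (R : realType) (V : normedModType R).

Lemma uniform_cvgP (A : set R) (f_ : nat -> R -> V) (f : R -> V) : {uniform A, f_ @ \oo --> f} <->
  forall e, 0 < e -> \forall l \near \oo, forall t, A t -> `|f_ l t - f t| < e.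
Proof.
split=> [fl e e0|H P].
  have : nbhs (f : {uniform` A -> V}) 
      [set h : {uniform` A -> V} | forall t, A t -> `|h t - f t| < e].
    apply/uniform_nbhs; exists [set xy | ball xy.1 e xy.2]; split.
      exact: (entourage_ball _ (PosNum e0)).
    by move=> h /= H t /H; rewrite -ball_normE /ball_/= distrC.
  by move/fl.
move=> /uniform_nbhs[E [+ EP]]; rewrite -entourage_ballE => -[e /= e0 eE].
apply: filterS (H e e0) => l Hl; apply: EP => /= y /Hl fy; apply: eE => /=.
by rewrite -ball_normE /ball_/= distrC.
Qed.

Lemma within_continuous_dist (A : set R) (f : R -> V) : {within A, continuous f} ->
  forall t e, A t -> 0 < e -> exists2 r, 0 < r &
    forall u, A u -> `|u - t| < r -> `|f u - f t| < e.
Proof.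
move=> /subspace_continuousP cf t e At e0.
have /cvgrPdist_lt/(_ e e0) := cf t At.
move=> /nbhs_ballP[r /= r0 H]; exists r => // u Au ut.
by rewrite distrC; apply: H => //; rewrite -ball_normE /ball_/= distrC.
Qed.

Definition locally_uniform (f_ : nat -> R -> V) (f : R -> V) := forall T e, 0 < e ->
  \forall l \near \oo, forall t, 0 <= t -> t <= T -> `|f_ l t - f t| < e.

End LocallyUniform.

Section Cousin.
Variable R : realType.

(** Compactness of an interval for a property that passes to unions of adjacent intervals: the
    supremum of the endpoints reached from [a] cannot lie below [b]. *)
Lemma interval_induction (P : R -> R -> Prop) a b : a <= b ->
  (forall x y z, a <= x -> x <= y -> y <= z -> z <= b -> P x y -> P y z -> P x z) ->
  (forall t, a <= t -> t <= b -> exists2 r, 0 < r & forall x y,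
     a <= x -> x <= t -> t <= y -> y <= b -> t - r < x -> y < t + r -> P x y) ->
  P a b.
Proof.
move=> ab Ptrans Ploc.
pose S := [set t | [/\ a <= t, t <= b & P a t]].
have Sa : S a.
  split => //; have [r r0] := Ploc a (lexx _) ab; apply => //; lra.
have supS : has_sup S by split; [exists a|exists b => t []].
pose s := sup S.
have as_ : a <= s by apply: ub_le_sup => //; case: supS.
have sb : s <= b by apply: ge_sup; [exists a|move=> t []].
have [r r0 hr] := Ploc s as_ sb.
have [t [at_ tb Pt] ts] := sup_adherent r0 supS.
have ts' : t <= s by apply: ub_le_sup => //; case: supS.
have Py y : s <= y -> y <= b -> y < s + r -> P a y.
  by move=> sy yb ysr; apply: (Ptrans a t y) => //; [lra|apply: hr].
have [bs|sb'] := leP b s; first by apply: Py => //; lra.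
pose y := Num.min b (s + r / 2).
have ys : s < y by rewrite lt_min sb'/=; lra.
have yb : y <= b by rewrite ge_min lexx.
have ysr : y < s + r by rewrite gt_min; apply/orP; right; lra.
have : S y by split => //; [lra|apply: Py => //; exact: ltW].
move=> /(ub_le_sup (proj2 supS)); rewrite -/s; lra.
Qed.

End Cousin.

Section SkorokhodContinuousLimit.
Variables (R : realType) (J : nat).

(** The time changes are close to the identity, and continuity of the limit absorbs them. *)
Lemma J1_cvg_continuous_limit (f_ : nat -> R -> 'rV[R]_J) f :
  cpath f -> J1_cvg f_ f -> locally_uniform f_ f.
Proof.
move=> cf [lam [tc lam_id fl]] T e e0.
have [T0|T0] := ltP T 0; first by near=> l => t t0 tT; lra.
pose P x y := \forall l \near \oo, forall t, x <= t -> t <= y -> `|f_ l t - f t| < e.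
suff : P 0 T by [].
apply: interval_induction => // [x y z _ xy yz _ Pxy Pyz|t t0 tT].
  near=> l => t xt tz; have [ty|yt] := leP t y.
    by have : forall t, x <= t -> t <= y -> `|f_ l t - f t| < e; [near: l|apply].
  have : forall t, y <= t -> t <= z -> `|f_ l t - f t| < e by near: l.
  by apply => //; exact: ltW.
have e3 : 0 < e / 3 by lra.
have t0' : `[0%R, +oo[%classic t by rewrite /= in_itv/= andbT.
have [r r0 hr] := within_continuous_dist cf t0' e3.
(* With [r / 2] the preimage [v] of [u] stays within [r] of [t]; with 1 it stays in [[0, T + 1]],
   where the uniform bound is available. *)
pose r' := Num.min (r / 2) 1.
have r'0 : 0 < r' by rewrite lt_min ltr01 andbT; lra.
have r'1 : r' <= 1 by rewrite ge_min lexx orbT.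
have r'r : r' <= r / 2 by rewrite ge_min lexx.
exists r' => // x y x0 xt ty yT xr yr.
have lamP := (uniform_cvgP _ _ _).1 lam_id _ r'0.
have fP := (uniform_cvgP _ _ _).1 (fl (T + 1)) _ e3.
rewrite /P; near=> l => u xu uy.
have lamu : forall t : R, `[0%R, +oo[%classic t -> `|lam l t - t| < r' by near: l.
have fu : forall t : R, `[0%R, (T + 1)]%classic t ->
    `|f_ l (lam l t) - f t| < e / 3 by near: l.
have u0 : 0 <= u by lra.
have [[_ _ surj] _] := tc l.
have [v] : [set lam l x | x in `[0%R, +oo[%classic] u.
  by apply: surj; rewrite /= in_itv/= andbT.
rewrite /= in_itv/= andbT => v0 vu.
have := lamu v; rewrite /= in_itv/= andbT vu => /(_ v0).
rewrite ltr_distl => /andP[uv1 uv2].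
have := fu v; rewrite /= in_itv/= vu => fv.
have {}fv : `|f_ l u - f v| < e / 3 by apply: fv; apply/andP; split; lra.
have fvt : `|f v - f t| < e / 3.
  apply: hr; first by rewrite /= in_itv/= andbT.
  by rewrite ltr_distl; apply/andP; split; lra.
have fut : `|f u - f t| < e / 3.
  apply: hr; first by rewrite /= in_itv/= andbT.
  by rewrite ltr_distl; apply/andP; split; lra.
have -> : f_ l u - f u = (f_ l u - f v) + (f v - f t) - (f u - f t).
  by rewrite opprB !addrA subrK subrK.
apply: le_lt_trans (ler_normB _ _) _; have := ler_normD (f_ l u - f v) (f v - f t).
by lra.
Unshelve. all: by end_near. Qed.

End SkorokhodContinuousLimit.

(** * Functionals on hulls, and active faces *)

Section Hulls.
Variables (R : realType) (J : nat).
Implicit Types (L x : 'rV[R]_J) (S : set 'rV[R]_J).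

Lemma conic_hull_le0 S L x :
  (forall y, S y -> dot L y <= 0) -> conic_hull S x -> dot L x <= 0.
Proof.
move=> HS [m [r [v [rv ->]]]]; rewrite dot_sumr.
apply: sumr_le0 => i _; rewrite dotZr; have [ri /HS vi] := rv i.
exact: mulr_ge0_le0.
Qed.

Lemma conic_hull_ge0 S L x :
  (forall y, S y -> 0 <= dot L y) -> conic_hull S x -> 0 <= dot L x.
Proof.
move=> HS Sx; rewrite -oppr_le0 -dotNl; apply: conic_hull_le0 Sx => y /HS.
by rewrite dotNl oppr_le0.
Qed.

Lemma linear_span_eq0 S L x :
  (forall y, S y -> dot L y = 0) -> linear_span S x -> dot L x = 0.
Proof.
move=> HS [m [r [v [rv ->]]]]; rewrite dot_sumr.
by apply: big1 => i _; rewrite dotZr (HS _ (rv i)) mulr0.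
Qed.

End Hulls.

Section ActiveSets.
Variables (R : realType) (J N : nat) (n : 'I_N -> 'rV[R]_J) (c : 'I_N -> R).
Hypothesis n1 : forall i, enorm (n i) = 1.

(** Moving against [n i] from a point where constraint [i] is tight leaves the polyhedron, so such a
    point is automatically on the boundary. *)
Lemma activeP x i : polyhedron n c x -> active n c x i <-> dot x (n i) = c i.
Proof.
move=> Gx; split => [[]//|xi]; split => //; split; first exact: subset_closure.
move=> /nbhs_ballP[r /= r0 rG].
have : polyhedron n c (x - (r / 2) *: n i).
  apply: rG; rewrite -ball_normE /ball_/= opprB addrC subrK normrZ gtr0_norm.
    by have := enorm1_norm_le (n1 i); nra.
  lra.
move=> /(_ i I) /=; rewrite dotBl dotZl xi enorm1_dotxx//; lra.
Qed.

(** The slack is continuous and positive on a compact interval. *)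
Lemma active_margin (h : R -> 'rV[R]_J) a b i : cpath h ->
  (forall t, 0 <= t -> polyhedron n c (h t)) -> 0 <= a -> a <= b ->
  (forall t, a <= t -> t <= b -> ~ active n c (h t) i) ->
  exists2 r, 0 < r & forall t, a <= t -> t <= b -> c i + r <= dot (h t) (n i).
Proof.
move=> ch Gh a0 ab hab.
apply: (@interval_induction _ (fun x y => exists2 r, 0 < r &
  forall t, x <= t -> t <= y -> c i + r <= dot (h t) (n i))) => //.
  move=> x y z _ xy yz _ [r1 r10 h1] [r2 r20 h2].
  exists (Num.min r1 r2); first by rewrite lt_min r10.
  move=> t xt tz; have [ty|/ltW yt] := leP t y.
    by apply: le_trans (h1 t xt ty); rewrite lerD2l ge_min lexx.
  by apply: le_trans (h2 t yt tz); rewrite lerD2l ge_min lexx orbT.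
move=> t at_ tb.
have t0 : 0 <= t by lra.
pose g := dot (h t) (n i) - c i.
have g0 : 0 < g.
  rewrite subr_gt0 lt_neqAle; apply/andP; split; last exact: Gh.
  by apply/eqP => /esym/(activeP i (Gh t t0)); exact: hab.
have J1 : 0 < 2 * (J%:R + 1) :> R by rewrite mulr_gt0// ltr_wpDl.
have t0' : `[0%R, +oo[%classic t by rewrite /= in_itv/= andbT.
have [r r0 hr] := within_continuous_dist ch t0' (divr_gt0 g0 J1).
exists r => // x y ax xt ty yb xr yr; exists (g / 2); first lra.
move=> u xu uy.
have hu : `|h u - h t| < g / (2 * (J%:R + 1)).
  apply: hr; first by rewrite /= in_itv/= andbT; lra.
  by rewrite ltr_distl; apply/andP; split; lra.
have := dot_lipschitz (ltW hu) (enorm1_norm_le (n1 i)).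
have : J%:R * (g / (2 * (J%:R + 1))) <= g / 2.
  rewrite mulrA ler_pdivrMr// [leRHS](_ : _ = (J%:R + 1) * g); last by field.
  by rewrite ler_wpM2r ?lerDl// ltW.
rewrite /g ler_norml => H1 /andP[H2 _]; lra.
Qed.

End ActiveSets.

(** * Stability of the reflection map *)

Section SkorokhodMap.
Variables (R : realType) (J N : nat) (n : 'I_N -> 'rV[R]_J) (c : 'I_N -> R).
Hypothesis n1 : forall i, enorm (n i) = 1.
Variable d : 'I_N -> 'rV[R]_J.
Hypothesis hdn : forall i, dot (d i) (n i) = 1.
Hypothesis A2 : assumption_A2 n d.

Lemma dcone_sign x L : (forall i, active n c x i -> dot L (d i) <= 0) ->
  forall y, dcone n c d x y -> dot L y <= 0.
Proof. by move=> HL y; apply: conic_hull_le0 => _ [i /HL ? <-]. Qed.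

Lemma dcone_sign_ge0 x L : (forall i, active n c x i -> 0 <= dot L (d i)) ->
  forall y, dcone n c d x y -> 0 <= dot L y.
Proof. by move=> HL y; apply: conic_hull_ge0 => _ [i /HL ? <-]. Qed.

(** The difference [g_l - g] moves up along faces active for [h_l] and down along faces active for
    [h]. When face [i] is active for one path, the other lies on the inner side of it, so the normal
    component of the difference has the required sign up to the error in [f]. *)
Lemma ESP_locally_uniform (f h g : R -> 'rV[R]_J) (f_ h_ g_ : nat -> R -> 'rV[R]_J) :
  solves_ESP n c d f h g -> (forall l, solves_ESP n c d (f_ l) (h_ l) (g_ l)) ->
  locally_uniform f_ f -> locally_uniform g_ g.
Proof.
move=> [[ch cg h0] [hE hG hinc hjump]] ESP_ fl T e e0.
have [p [mu [k [C [k0 C0 Cp _ [mu_p mu_le mu1 mu2]]]]]] := A2_gauge hdn A2.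
(* The gauge estimate then yields [3 / 4 * e], leaving room for the strict inequality. *)
pose e1 := e * k / (4 * C).
have e10 : 0 < e1 by rewrite divr_gt0// !mulr_gt0.
pose e2 := e1 / (J%:R + 1).
have J1 : 0 < J%:R + 1 :> R by rewrite ltr_wpDl.
have e20 : 0 < e2 by rewrite divr_gt0.
have Je : J%:R * e2 <= e1.
  by rewrite mulrA ler_pdivrMr// mulrC (ler_wpM2l (ltW e10))// lerDl.
near=> l => t t0 tT.
have flT : forall t, 0 <= t -> t <= T -> `|f_ l t - f t| < e2.
  by near: l; exact: fl.
have [[chl cgl hl0] [hlE hlG hlinc hljump]] := ESP_ l.
apply: (@le_lt_trans _ _ (C * (3 * e1 / k))); last first.
  rewrite [ltLHS](_ : _ = 3 / 4 * e); last first.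
    by rewrite /e1; field; rewrite !gt_eqF.
  lra.
apply: le_trans (Cp _) _; apply: ler_wpM2l; first exact: ltW.
have gdiff u i : 0 <= u -> u <= T ->
    dot (g_ l u - g u) (n i) <= dot (h_ l u) (n i) - dot (h u) (n i) + e1 /\
    dot (h_ l u) (n i) - dot (h u) (n i) - e1 <= dot (g_ l u - g u) (n i).
  move=> u0 uT; have := dot_lipschitz (ltW (flT u u0 uT)) (enorm1_norm_le (n1 i)).
  by rewrite hlE// hE// !dotBl !dotDl ler_norml => /andP[]; lra.
have n1' i : `|n i| <= 1 by exact: enorm1_norm_le.
apply: (@gauge_bound _ _ _ n d n1' p mu k k0 mu_p mu_le mu1 mu2
  (fun t => g_ l t - g t) T e1 (fun i u => active n c (h_ l u) i)
  (fun i u => active n c (h u) i)) => //.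
- by move=> u u0; apply: cvgB; [apply: (proj1 cgl)|apply: (proj1 cg)].
- move=> u u0 uT; exists (left_limit (g_ l) u - left_limit g u).
    by apply: cvgB; [apply: (proj2 cgl)|apply: (proj2 cg)].
  move=> L HL.
  have : dot L (g_ l u - left_limit (g_ l) u) <= 0.
    apply: conic_hull_le0 (hljump u u0); apply: dcone_sign => i; exact: (HL i).1.
  have : 0 <= dot L (g u - left_limit g u).
    apply: conic_hull_ge0 (hjump u u0); apply: dcone_sign_ge0 => i; exact: (HL i).2.
  rewrite !dotBr; lra.
- move=> s u s0 su uT L HL.
  have : dot L (g_ l u - g_ l s) <= 0.
    apply: conic_hull_le0 (hlinc s u s0 su) => y [v /=]; rewrite in_itv/= => /andP[sv vu].
    by apply: dcone_sign => i; exact: (HL v sv vu i).1.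
  have : 0 <= dot L (g u - g s).
    apply: conic_hull_ge0 (hinc s u s0 su) => y [v /=]; rewrite in_itv/= => /andP[sv vu].
    by apply: dcone_sign_ge0 => i; exact: (HL v sv vu i).2.
  rewrite !dotBr; lra.
- move=> L _.
  have -> : g 0 = 0 by apply: (@addrI _ (f 0)); rewrite addr0 -hE// h0.
  have -> : g_ l 0 = 0 by apply: (@addrI _ (f_ l 0)); rewrite addr0 -hlE// hl0.
  by rewrite subrr dot0r.
- move=> i u u0 uT /activeP -/(_ n1 (hlG u u0)) hi.
  by have [+ _] := gdiff u i u0 uT; have := hG u u0 i I; rewrite /= hi; lra.
- move=> i u u0 uT /activeP -/(_ n1 (hG u u0)) hi.
  by have [_] := gdiff u i u0 uT; have := hlG u u0 i I; rewrite /= hi; lra.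
Unshelve. all: by end_near. Qed.

End SkorokhodMap.

(** * Transversality of directions and hyperplanes *)

Section Pushing.
Variables (R : realType) (J N : nat) (n : 'I_N -> 'rV[R]_J) (c : 'I_N -> R).
Variable d : 'I_N -> 'rV[R]_J.

Lemma conic_hull_neq0 (S : set 'rV[R]_J) x : conic_hull S x -> x != 0 ->
  exists2 y, S y & y != 0.
Proof.
move=> [m [r [v [rv ->]]]] x0; apply: contrapT => noy; move/negP: x0; apply.
rewrite big1// => i _; have [_ Sv] := rv i.
have [->|v0] := eqVneq (v i) 0; first by rewrite scaler0.
by exfalso; apply: noy; exists (v i).
Qed.

Lemma dcone_neq0 x y : dcone n c d x y -> y != 0 -> exists i, active n c x i.
Proof. by move=> /conic_hull_neq0 /[apply] -[_ [i ai _] _]; exists i. Qed.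

Lemma dcone_eq0 x L : (forall i, active n c x i -> dot L (d i) = 0) ->
  forall y, dcone n c d x y -> dot L y = 0.
Proof.
move=> HL y yx; apply/eqP; rewrite eq_le; apply/andP; split.
  by apply: dcone_sign yx => i /HL ->.
by apply: dcone_sign_ge0 yx => i /HL ->.
Qed.

(** A vector of the active hyperplanes is inside the band of every active face, so its supporting
    functional annihilates all active [d i], hence the vector itself; but its value there is the
    gauge. *)
Lemma span_dcone_hyperplanes x y :
  (forall i, dot (d i) (n i) = 1) -> assumption_A2 n d ->
  linear_span (dcone n c d x) y -> active_hyperplanes n c x y -> y = 0.
Proof.
move=> hdn A2 sy hy.
have [p [mu [k [C [k0 C0 Cp _ [mu_p mu_le mu1 mu2]]]]]] := A2_gauge hdn A2.
have [py|py] := leP (p y) 0.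
  by apply/eqP; rewrite -normr_le0; apply: le_trans (Cp _) _; rewrite pmulr_rle0.
have kp : 0 < k * p y by rewrite mulr_gt0.
suff : p y = 0 by move=> py0; move: py; rewrite py0 ltxx.
rewrite -mu_p; apply: linear_span_eq0 sy => w; apply: dcone_eq0 => i ai.
have := hy i ai; rewrite /= => yi.
apply/eqP; rewrite eq_le mu1 ?yi//= mu2 ?yi//.
by rewrite oppr_lt0.
Qed.

End Pushing.

(** * Consequences of the boundary jitter property *)

Section JitterTimes.
Variables (R : realType) (J N : nat) (n : 'I_N -> 'rV[R]_J) (c : 'I_N -> R).
Hypothesis n1 : forall i, enorm (n i) = 1.
Variables (h : R -> 'rV[R]_J).
Hypotheses (ch : cpath h) (Gh : forall t, 0 <= t -> polyhedron n c (h t)).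

(** Freezing the path before time 0 makes the set of boundary times closed in [R], hence
    measurable. *)
Lemma cpath_extend : continuous (fun t : R => h (Num.max t 0)).
Proof.
move=> t; apply/cvgrPdist_lt => e e0.
have m0 s : `[0%R, +oo[%classic (Num.max s 0 : R).
  by rewrite /= in_itv/= andbT le_max lexx orbT.
have [r r0 hr] := within_continuous_dist ch (m0 t) e0.
apply/nbhs_ballP; exists r => //= u; rewrite /ball_/= => tu.
rewrite distrC; apply: hr => //; apply: le_lt_trans tu.
have := ler_norm (t - u); have := ler_norm (u - t); rewrite (distrC u t) ler_norml.
by case: (leP t 0) => t0; case: (leP u 0) => u0 h1 h2; apply/andP; split; lra.
Qed.

Lemma boundary_closed (T : topologicalType) (A : set T) : closed (boundary A).
Proof.
rewrite /boundary setDE; apply: closedI; first exact: closed_closure.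
by apply: open_closedC; exact: open_interior.
Qed.

Lemma inactive_time :
  (\int[lebesgue_measure]_(s in `[0%R, +oo[%classic)
         (\1_(boundary (polyhedron n c)) (h s))%:E = 0)%E ->
  forall a b, 0 <= a -> a < b ->
  exists u, [/\ a < u, u < b & forall i, ~ active n c (h u) i].
Proof.
move=> int0 a b a0 ab; apply: contrapT => nou.
have bd u : a < u -> u < b -> boundary (polyhedron n c) (h u).
  move=> au ub; apply: contrapT => nb; apply: nou; exists u; split => // i [].
  by move/nb.
pose E := (fun t : R => h (Num.max t 0)) @^-1` (boundary (polyhedron n c)).
have cE : closed E.
  apply: preimage_closed; last exact: boundary_closed.
  by move=> x _; exact: cpath_extend.
have mE : measurable E by exact: measurable_realfun.closed_measurable.
have mD : measurable (`[0%R, +oo[%classic : set R) by [].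
have : lebesgue_measure (E `&` `[0%R, +oo[%classic) = 0%E.
  have indicE' (x : R) : 0 <= x ->
      \1_E x = \1_(boundary (polyhedron n c)) (h x) :> R.
    move=> x0; have xm : Num.max x 0 = x by rewrite max_l.
    by rewrite !indicE -[X in _ = (h X \in _)%:R]xm.
  rewrite -(integral_indic lebesgue_measure mD mE) -[in RHS]int0.
  by apply: eq_integral => x; rewrite inE /= in_itv /= andbT => /indicE' ->.
move=> mu0.
have : (lebesgue_measure (`]a, b[%classic : set R) <= 0)%E.
  rewrite -mu0; apply: le_measure; rewrite ?inE//; first exact: measurableI.
  move=> u /=; rewrite in_itv/= => /andP[au ub]; split; last by rewrite in_itv/= andbT; lra.
  by rewrite /E/= max_l; [exact: bd|lra].
rewrite lebesgue_measure_itv/= lte_fin ab -EFinB lee_fin; lra.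
Qed.

(** If a second face [j] is active at [t], then [h t] is a nonsmooth point and jitter supplies an
    earlier time at which [i] is alone. *)
Lemma single_active_time :
  (forall t, 0 < t -> nonsmooth n c (h t) ->
        forall i, active n c (h t) i -> forall delta, 0 < delta < t ->
        exists2 s : R, t - delta < s < t & active n c (h s) = [set i]) ->
  forall t i r, 0 < t -> active n c (h t) i -> 0 < r ->
  active n c (h t) = [set i] \/
  exists s, [/\ 0 < s, t - r < s, s < t & active n c (h s) = [set i]].
Proof.
move=> jit t i r t0 ai r0.
have [|ni] := pselect (active n c (h t) = [set i]); [by left|right].
have [j ji aj] : exists2 j, j != i & active n c (h t) j.
  apply: contrapT => noj; apply: ni; apply/seteqP; split => [j aj|j ->//].
  by apply: contrapT => /eqP ji; apply: noj; exists j.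
have ns : nonsmooth n c (h t).
  split; first by case: ai.
  apply: (@card_le_trans _ _ _ [set i; j]); last first.
    by apply: subset_card_le => l [->|->].
  have -> : `I_2 = (fun l => nat_of_bool (l == j)) @` [set i; j].
    apply/seteqP; split => [[|[|//]] _|_ [l [->|->] <-]].
    - by exists i; [left|rewrite eq_sym (negbTE ji)].
    - by exists j; [right|rewrite eqxx].
    - by rewrite eq_sym (negbTE ji).
    - by rewrite eqxx.
  exact: card_image_le.
pose dl := Num.min (r / 2) (t / 2).
have dl1 : dl <= r / 2 by rewrite ge_min lexx.
have dl2 : dl <= t / 2 by rewrite ge_min lexx orbT.
have dl0 : 0 < dl by rewrite lt_min; apply/andP; split; lra.
have dlt : 0 < dl < t by rewrite dl0/=; lra.
have [s /andP[s1 s2] as_] := jit t t0 ns i ai dl dlt.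
by exists s; split => //; lra.
Qed.

(** Each inactive face keeps a positive slack nearby, and there are finitely many faces. *)
Lemma active_usc t : 0 <= t -> exists2 r, 0 < r &
  forall u, 0 <= u -> `|u - t| < r -> forall i, active n c (h u) i -> active n c (h t) i.
Proof.
move=> t0.
have H i : \forall r \near (0 : R)^'+, forall u, 0 <= u -> `|u - t| < r ->
    active n c (h u) i -> active n c (h t) i.
  have [ai|ai] := pselect (active n c (h t) i).
    by near=> r.
  have [r1 r10 h1] : exists2 r, 0 < r & forall u, 0 <= u -> `|u - t| < r ->
      ~ active n c (h u) i.
    have [] := @active_margin _ _ _ n c n1 h t t i ch Gh t0 (lexx _).
      by move=> u tu ut; have -> : u = t by lra.
    move=> m m0 /(_ t (lexx _) (lexx _)) hm.
    have J1 : 0 < (J%:R + 1) :> R by rewrite ltr_wpDl.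
    have t0' : `[0%R, +oo[%classic t by rewrite /= in_itv/= andbT.
    have [r r0 hr] := within_continuous_dist ch t0' (divr_gt0 m0 J1).
    exists r => // u u0 ut /(activeP n1 i (Gh u0)) hu.
    have u0' : `[0%R, +oo[%classic u by rewrite /= in_itv/= andbT.
    have := dot_lipschitz (ltW (hr u u0' ut)) (enorm1_norm_le (n1 i)).
    have : J%:R * (m / (J%:R + 1)) < m.
      by rewrite mulrA ltr_pdivrMr// mulrC ltr_pM2l// ltrDl.
    by rewrite hu ler_norml => H1 /andP[H2 _]; lra.
  near=> r => u u0 ut; have rr1 : r < r1 by near: r; exact: nbhs_right_lt.
  by move=> au; exfalso; apply: (h1 u u0 _ au); lra.
have /filter_forall Hf := H.
have [r [r0 hr]] : exists r, 0 < r /\ forall i u, 0 <= u -> `|u - t| < r ->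
    active n c (h u) i -> active n c (h t) i.
  apply: (@filter_ex _ (0 : R)^'+).
  near=> r; split; first by near: r; exact: nbhs_right_gt.
  by near: r; exact: Hf.
by exists r => // u u0 ut i; exact: hr.
Unshelve. all: by end_near. Qed.

Variables (h_ : nat -> R -> 'rV[R]_J).
Hypotheses (Gh_ : forall l t, 0 <= t -> polyhedron n c (h_ l t))
  (hl : locally_uniform h_ h).

Lemma inactive_approx a b i : 0 <= a -> a <= b ->
  (forall t, a <= t -> t <= b -> ~ active n c (h t) i) ->
  \forall l \near \oo, forall t, a <= t -> t <= b -> ~ active n c (h_ l t) i.
Proof.
move=> a0 ab na.
have [m m0 hm] := active_margin n1 ch Gh a0 ab na.
have J1 : 0 < (J%:R + 1) :> R by rewrite ltr_wpDl.
apply: filterS (hl b (divr_gt0 m0 J1)) => l H t at_ tb.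
have t0 : 0 <= t by lra.
move=> /(activeP n1 i (Gh_ l t0)) hu.
have := dot_lipschitz (ltW (H t t0 tb)) (enorm1_norm_le (n1 i)).
have : J%:R * (m / (J%:R + 1)) < m.
  by rewrite mulrA ltr_pdivrMr// mulrC ltr_pM2l// ltrDl.
by have := hm t at_ tb; rewrite hu ler_norml => H0 H1 /andP[H2 _]; lra.
Qed.

Variables (d : 'I_N -> 'rV[R]_J) (g : R -> 'rV[R]_J) (g_ : nat -> R -> 'rV[R]_J).
Hypotheses (gl : locally_uniform g_ g)
  (g_inc : forall l s t, 0 <= s -> s < t ->
    conic_hull (\bigcup_(u in `]s, t]%classic) dcone n c d (h_ l u)) (g_ l t - g_ l s)).

(** Near [u] the term [g] is not constant, so neither is [g_l] for large [l]. It can only move while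
    [h_l] is on some face, and every face other than [i] is out of reach on this window. *)
Lemma hit_approx u i r :
  (forall t1 t2, t1 < u < t2 -> exists s s',
     [/\ Num.max t1 0 < s < t2, Num.max t1 0 < s' < t2 & g s <> g s']) ->
  0 < u -> active n c (h u) = [set i] -> 0 < r ->
  \forall l \near \oo, exists v, [/\ 0 < v, u - r < v, v < u + r & active n c (h_ l v) i].
Proof.
move=> jit u0 hu r0.
have [r1 r10 h1] := active_usc (ltW u0).
(* The window must fit in the requested one, stay at positive times, and meet no face of [h] except
   [i]. *)
pose q := Num.min (Num.min (r / 2) (r1 / 2)) (u / 2).
have q1 : q <= r / 2 by rewrite !ge_min lexx.
have q2 : q <= r1 / 2 by rewrite !ge_min lexx orbT.
have q3 : q <= u / 2 by rewrite ge_min lexx orbT.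
have q0 : 0 < q by rewrite !lt_min -andbA; apply/and3P; split; lra.
have [] := jit (u - q) (u + q); first by apply/andP; split; lra.
move=> s0 [s0' [hs0 hs0' gs0]].
have [s [s' [us ss' s'u gs]]] :
    exists s s', [/\ u - q < s, s < s', s' < u + q & g s' - g s != 0].
  move: hs0 hs0'; rewrite !gt_max => /andP[/andP[a1 a2] a3] /andP[/andP[b1 b2] b3].
  have [E|E|E] := ltgtP s0 s0'.
  - by exists s0, s0'; split => //; rewrite subr_eq0; apply/eqP => /esym.
  - by exists s0', s0; split => //; rewrite subr_eq0; apply/eqP.
  - by case: gs0; rewrite E.
pose e := `|g s' - g s| / 2.
have e0 : 0 < e by rewrite divr_gt0// normr_gt0.
have noj : \forall l \near \oo, forall j, j != i ->
    forall t, u - q <= t -> t <= u + q -> ~ active n c (h_ l t) j.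
  apply: filter_forall => j.
  have [->|ji] := eqVneq j i; first by near=> l.
  have nj t : u - q <= t -> t <= u + q -> ~ active n c (h t) j.
    move=> t1 t2 /(h1 t) -/(_ _ _)/= H; have : active n c (h u) j.
      by apply: H; [lra|rewrite ltr_norml; apply/andP; split; lra].
    by rewrite hu /= => /eqP; rewrite (negbTE ji).
  have H := @inactive_approx (u - q) (u + q) j _ _ nj.
  by apply: filterS (H _ _) => [l Hl _ //| |]; lra.
near=> l.
have gs_ : forall t, 0 <= t -> t <= u + q -> `|g_ l t - g t| < e by near: l; exact: gl.
have nojl : forall j, j != i -> forall t, u - q <= t -> t <= u + q ->
  ~ active n c (h_ l t) j by near: l.
have gl0 : g_ l s' - g_ l s != 0.
  apply/eqP => E.
  have G1 : `|g_ l s - g s| < e by apply: gs_; lra.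
  have G2 : `|g_ l s' - g s'| < e by apply: gs_; lra.
  have : g s' - g s = (g_ l s - g s) - (g_ l s' - g s').
    move/eqP: E; rewrite subr_eq0 => /eqP ->.
    by rewrite opprB [RHS]addrC addrA subrK.
  have := ler_normB (g_ l s - g s) (g_ l s' - g s').
  by move=> + H; rewrite -H /e in G1 G2 *; lra.
have s0_ : 0 <= s by lra.
have [y [v /=] + + y0] := conic_hull_neq0 (g_inc l s0_ ss') gl0.
rewrite in_itv/= => /andP[sv vs'] /dcone_neq0 /(_ y0)[j aj].
have ji : j = i.
  by apply: contrapT => /eqP ji; apply: (nojl j ji v _ _ aj); lra.
by exists v; rewrite -ji; split => //; lra.
Unshelve. all: by end_near. Qed.

End JitterTimes.

(** * Where the solution of the derivative problem can jump *)

Section JumpTimes.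
Variables (R : realType) (J N : nat) (n : 'I_N -> 'rV[R]_J) (c : 'I_N -> R).
Hypothesis n1 : forall i, enorm (n i) = 1.
Variable d : 'I_N -> 'rV[R]_J.
Hypothesis hdn : forall i, dot (d i) (n i) = 1.
Hypothesis A2 : assumption_A2 n d.
Variables (h psi phi eta : R -> 'rV[R]_J).
Hypotheses (ch : cpath h) (Gh : forall t, 0 <= t -> polyhedron n c (h t))
  (cpsi : cpath psi) (D : solves_derivative_problem n c d h psi phi eta).

(** Both [phi 0] and [psi 0] lie in the active hyperplanes, so transversality applies to their
    difference. *)
Lemma eta0 : active_hyperplanes n c (h 0) (psi 0) -> eta 0 = 0.
Proof.
have [[_ _ s0] [phiE Hphi _ _]] := D => Hpsi.
apply: span_dcone_hyperplanes s0 _ => // i ai.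
have := Hphi 0 (lexx _) i ai; have := Hpsi i ai.
by rewrite /= phiE// dotDl => ->; rewrite add0r.
Qed.

Lemma path_continuous (f : R -> 'rV[R]_J) t e : cpath f -> 0 <= t -> 0 < e ->
  exists2 r, 0 < r & forall u, 0 <= u -> t - r < u -> u < t + r -> `|f u - f t| < e.
Proof.
move=> cf t0 e0; have t0' : `[0%R, +oo[%classic t by rewrite /= in_itv/= andbT.
have [r r0 hr] := within_continuous_dist cf t0' e0.
exists r => // u u0 u1 u2; apply: hr; first by rewrite /= in_itv/= andbT.
by rewrite ltr_distl; apply/andP; split; lra.
Qed.

(** If every face active at [t] is also visited just before [t], the left limit of [phi] lies in the
    active hyperplanes, and transversality kills the jump. Otherwise some active face is not visited
    just before [t]. Jitter then makes it the only active face, and semicontinuity leaves no other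
    face for the times just before. *)
Lemma jump_dichotomy t :
  (forall t, 0 < t -> nonsmooth n c (h t) ->
        forall i, active n c (h t) i -> forall delta, 0 < delta < t ->
        exists2 s : R, t - delta < s < t & active n c (h s) = [set i]) ->
  0 < t ->
  phi u @[u --> t^'-] --> phi t \/
  exists2 i, active n c (h t) = [set i] & exists2 r, 0 < r &
    forall u, 0 <= u -> t - r < u -> u < t -> forall j, ~ active n c (h u) j.
Proof.
have [[cphi ceta _] [phiE Hphi _ jumps]] := D => jit t0.
have [freq|nfreq] := pselect (forall i, active n c (h t) i -> forall r, 0 < r ->
    exists u, [/\ 0 <= u, t - r < u, u < t & active n c (h u) i]).
  left; pose pl := psi t + left_limit eta t.
  have plP e : 0 < e -> exists2 r, 0 < r &
      forall u, 0 <= u -> t - r < u -> u < t -> `|phi u - pl| < e.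
    move=> e0; have e2 : 0 < e / 2 by lra.
    have [r1 r10 h1] := path_continuous cpsi (ltW t0) e2.
    have [r2 r20 h2] := cvg_left_dist (proj2 ceta t t0) e2.
    exists (Num.min r1 r2); first by rewrite lt_min r10.
    move=> u u0 u1 u2; rewrite phiE// opprD addrACA.
    apply: le_lt_trans (ler_normD _ _) _.
    have ru1 : t - r1 < u by apply: le_lt_trans u1; rewrite lerD2l lerN2 ge_min lexx.
    have ru2 : t - r2 < u by apply: le_lt_trans u1; rewrite lerD2l lerN2 ge_min lexx orbT.
    have := h1 u u0 ru1; have := h2 u ru2 u2; rewrite -/(left_limit eta t) => H2 H1.
    have ut1 : u < t + r1 by lra.
    by have := H1 ut1; lra.
  have xE : phi t - pl = eta t - left_limit eta t.
    by rewrite phiE ?(ltW t0)// opprD addrACA subrr add0r.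
  have x0 : phi t - pl = 0.
    apply: (@span_dcone_hyperplanes _ _ _ n c d (h t)) => //.
      by rewrite xE; exact: jumps.
    move=> i ai /=; rewrite dotBl (Hphi t (ltW t0) i ai) sub0r.
    apply/eqP; rewrite oppr_eq0 -normr_le0; apply/ler_addgt0Pr => e e0; rewrite add0r.
    have J1 : 0 < (J%:R + 1) :> R by rewrite ltr_wpDl.
    have [r r0 hr] := plP _ (divr_gt0 e0 J1).
    have [u [u0 u1 u2 au]] := freq i ai r r0.
    have := dot_lipschitz (ltW (hr u u0 u1 u2)) (enorm1_norm_le (n1 i)).
    rewrite (Hphi u u0 i au) sub0r normrN => /le_trans; apply.
    by rewrite mulrA ler_pdivrMr// mulrC (ler_wpM2l (ltW e0))// lerDl.
  apply: dist_cvg_left => e /plP[r r0 hr]; exists (Num.min r t).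
    by rewrite lt_min r0.
  move=> u u1 u2; move/eqP: x0; rewrite subr_eq0 => /eqP ->; apply: hr => //.
    by have : Num.min r t <= t by [rewrite ge_min lexx orbT]; lra.
  by apply: le_lt_trans u1; rewrite lerD2l lerN2 ge_min lexx.
right.
have [i [ai [r [r0 nr]]]] : exists i, active n c (h t) i /\ exists r, 0 < r /\
    forall u, 0 <= u -> t - r < u -> u < t -> ~ active n c (h u) i.
  apply: contrapT => H; apply: nfreq => i ai r r0; apply: contrapT => nu; apply: H.
  exists i; split => //; exists r; split => // u u0 u1 u2 au; apply: nu.
  by exists u.
have ti : active n c (h t) = [set i].
  have [//|[s [s0 s1 s2 as_]]] := single_active_time jit t0 ai r0.
  by exfalso; apply: (nr s (ltW s0) s1 s2); rewrite as_.
exists i => //.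
have [r' r'0 hr'] := active_usc n1 ch Gh (ltW t0).
exists (Num.min r r'); first by rewrite lt_min r0.
move=> u u0 u1 u2 j aj.
have ru1 : t - r < u by apply: le_lt_trans u1; rewrite lerD2l lerN2 ge_min lexx.
have ru2 : t - r' < u by apply: le_lt_trans u1; rewrite lerD2l lerN2 ge_min lexx orbT.
have : active n c (h t) j.
  by apply: (hr' u u0 _ j aj); rewrite ltr_distl; apply/andP; split; lra.
by rewrite ti /= => ji; move: aj; rewrite ji; exact: nr.
Qed.

End JumpTimes.

(** * Coefficients of increments, and finite sums of jumps *)

Section Coefficients.
Variables (R : realType) (J N : nat) (d : 'I_N -> 'rV[R]_J).

(** The row space of the matrix is the span of the [d i] with [i] in [I]; zero rows give all sets
    [I] the same shape. A single [C] must serve all [I], as pieces visit different faces. *)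
Definition push_constant (C : R) := 0 <= C /\
  forall (I : {set 'I_N}) (x : 'rV[R]_J),
    (x <= \matrix_(i < N) (if i \in I then d i else 0))%MS ->
    exists2 r : 'I_N -> R, x = \sum_(i in I) r i *: d i &
      forall i, `|r i| <= C * `|x|.

(** A pseudo-inverse yields coefficients linear in [x], and the bounds are summed over the finitely
    many [I]. *)
Lemma push_constant_exists : exists C, push_constant C.
Proof.
pose A (I : {set 'I_N}) : 'M[R]_(N, J) := \matrix_(i < N) (if i \in I then d i else 0).
pose q I i : 'rV[R]_J := (col i (pinvmx (A I)))^T.
exists (\sum_I \sum_i J%:R * `|q I i|); split.
  by apply: sumr_ge0 => I _; apply: sumr_ge0 => i _; rewrite mulr_ge0.
move=> I x /mulmxKpV xE; exists (fun i => dot x (q I i)).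
  rewrite -[LHS]xE mulmx_sum_row [RHS]big_mkcond; apply: eq_bigr => i _.
  rewrite rowK; case: ifP => _; last by rewrite scaler0.
  by congr (_ *: _); rewrite mxE; apply: eq_bigr => j _; rewrite !mxE.
move=> i; apply: le_trans (normr_dot_le _ _) _.
rewrite mulrAC; apply: ler_wpM2r => //.
rewrite (bigD1 I)//= (bigD1 i)//= -addrA lerDl addr_ge0//.
  by apply: sumr_ge0 => k _; rewrite mulr_ge0.
by apply: sumr_ge0 => K _; apply: sumr_ge0 => k _; rewrite mulr_ge0.
Qed.

Lemma linear_span_submx m (A : 'M[R]_(m, J)) (S : set 'rV[R]_J) x :
  (forall y, S y -> (y <= A)%MS) -> linear_span S x -> (x <= A)%MS.
Proof.
move=> SA [k [r [v [Sv ->]]]]; apply: summx_sub => i _.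
exact/scalemx_sub/SA.
Qed.

Lemma conic_hull_submx m (A : 'M[R]_(m, J)) (S : set 'rV[R]_J) x :
  (forall y, S y -> (y <= A)%MS) -> conic_hull S x -> (x <= A)%MS.
Proof.
move=> SA [k [r [v [Sv ->]]]]; apply: summx_sub => i _.
by apply/scalemx_sub/SA; have [] := Sv i.
Qed.

End Coefficients.

Section Pushes.
Variables (R : realType) (J N : nat) (d : 'I_N -> 'rV[R]_J).
Implicit Types (es : seq (R * 'I_N * R)) (u t : R).

(* An entry [(v, i, r)] stands for a jump [r *: d i] at time [v]. *)
Definition pushes es u : 'rV[R]_J := \sum_(e <- es | e.1.1 <= u) e.2 *: d e.1.2.

Lemma pushes_cat es es' u : pushes (es ++ es') u = pushes es u + pushes es' u.
Proof. exact: big_cat. Qed.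

Lemma pushes_lt es u : (forall e, e \in es -> u < e.1.1) -> pushes es u = 0.
Proof.
move=> H; rewrite /pushes big_seq_cond big1// => e /andP[/H + eu].
by rewrite ltNge eu.
Qed.

Lemma pushes_const es u t : (forall e, e \in es -> (e.1.1 <= u) = (e.1.1 <= t)) ->
  pushes es u = pushes es t.
Proof.
move=> H; rewrite /pushes big_seq_cond [RHS]big_seq_cond; apply: eq_bigl => e.
by have [/H|//] := boolP (e \in es).
Qed.

Lemma pushes_dot es L s t : s <= t ->
  (forall e, e \in es -> s < e.1.1 -> e.1.1 <= t -> dot L (d e.1.2) = 0) ->
  dot L (pushes es t - pushes es s) = 0.
Proof.
move=> st; rewrite /pushes; elim: es => [|e es IH] H; first by rewrite !big_nil subrr dot0r.
have {}IH : dot L (pushes es t - pushes es s) = 0.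
  by apply: IH => e' e'es; apply: H; rewrite inE e'es orbT.
move: IH; rewrite !big_cons !dotBr /pushes => IH.
have [es_|se] := leP e.1.1 s.
  by rewrite (le_trans es_ st) !dotDr; lra.
have [et|//] := leP e.1.1 t.
by rewrite dotDr dotZr H ?mem_head// mulr0 add0r.
Qed.

Lemma pushes_isolated es t : exists2 r, 0 < r & forall e, e \in es ->
  (e.1.1 < t -> e.1.1 <= t - r) /\ (t < e.1.1 -> t + r <= e.1.1).
Proof.
elim: es => [|e es [r r0 hr]]; first by exists 1.
pose q := if e.1.1 == t then 1 else `|e.1.1 - t|.
have q0 : 0 < q by rewrite /q; case: eqVneq => // et; rewrite normr_gt0 subr_eq0.
exists (Num.min r q); first by rewrite lt_min r0.
have mr : Num.min r q <= r by rewrite ge_min lexx.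
have mq : Num.min r q <= q by rewrite ge_min lexx orbT.
move=> e'; rewrite inE => /orP[/eqP ->|/hr[h1 h2]]; last first.
  by split => [/h1|/h2]; lra.
move: mq; rewrite /q; split => et.
  by move: mq; rewrite /q lt_eqF// ltr0_norm ?subr_lt0//; lra.
by move: mq; rewrite /q gt_eqF// gtr0_norm ?subr_gt0//; lra.
Qed.

Lemma pushes_right_continuous es t : pushes es u @[u --> t^'+] --> pushes es t.
Proof.
have [r r0 hr] := pushes_isolated es t.
apply: dist_cvg_right => e e0; exists r => // u tu ur.
rewrite (@pushes_const es u t) ?subrr ?normr0// => e' /hr[_ h].
have [e't|te'] := leP e'.1.1 t; first by rewrite (le_trans e't)// ltW.
by apply/negbTE; rewrite -ltNge; have := h te'; lra.
Qed.

(** The left limit is given as a value at an earlier [s] with no jump strictly between, so that a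
    jump becomes an ordinary increment for [pushes_dot]. *)
Lemma pushes_left_limit es t : exists2 s, s < t &
  pushes es u @[u --> t^'-] --> pushes es s /\
  forall e, e \in es -> s < e.1.1 -> t <= e.1.1.
Proof.
have [r r0 hr] := pushes_isolated es t; exists (t - r); first lra.
have H e : e \in es -> t - r < e.1.1 -> t <= e.1.1.
  by move=> /hr[h _] te; rewrite leNgt; apply/negP => /h; lra.
split => //; apply: dist_cvg_left => e e0; exists r => // u tu ut.
rewrite (@pushes_const es u (t - r)) ?subrr ?normr0// => e' /H h.
have [e't|te'] := leP e'.1.1 (t - r); first by rewrite (le_trans e't)// ltW.
by apply/negbTE; rewrite -ltNge; have := h te'; lra.
Qed.

End Pushes.

(** * Time changes supported in one piece *)

Section LocalTimeChange.
Variable R : realType.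
Implicit Types (lam : R -> R) (a b e t s u : R).

(** Being the identity outside [[a, b]], time changes of adjacent pieces do not interact, and the
    displacement bound [e] survives their composition. *)
Definition local_time_change e a b lam :=
  [/\ {homo lam : x y / x < y}, forall y, exists x, lam x = y,
      forall u, u <= a \/ b <= u -> lam u = u & forall u, `|lam u - u| <= e].

Lemma local_time_change_id e a b : 0 <= e -> local_time_change e a b id.
Proof. by move=> e0; split => // [y|u]; [exists y|rewrite subrr normr0]. Qed.

Lemma local_time_change_itv e a b lam : local_time_change e a b lam ->
  forall u, a <= u -> u <= b -> a <= lam u /\ lam u <= b.
Proof.
move=> [lam_lt _ lam_id _] u au ub.
have lam_le : {homo lam : x y / x <= y} by exact/ltW_homo.
split; [rewrite -(lam_id a); last by left|rewrite -(lam_id b); last by right]; exact: lam_le.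
Qed.

Lemma local_time_change_comp e a b c lam mu : a <= b -> b <= c ->
  local_time_change e a b lam -> local_time_change e b c mu ->
  local_time_change e a c (lam \o mu).
Proof.
move=> ab bc hl hm; have [l1 l2 l3 l4] := hl; have [m1 m2 m3 m4] := hm.
split => [x y xy|y|u|u] /=.
- exact/l1/m1.
- by have [x <-] := l2 y; have [z <-] := m2 x; exists z.
- by move=> [ua|cu]; rewrite m3; try (by right); try (by left; lra);
    apply: l3; [left|right; lra].
- have [ub|/ltW bu] := leP u b; first by rewrite m3//; left.
  suff bm : b <= mu u by rewrite l3//; right.
  have [uc|/ltW cu] := leP u c; first by have [] := local_time_change_itv hm bu uc.
  by rewrite m3//; right.
Qed.

(** Take the piecewise linear map with nodes [a], [t], [b] sent to [a], [s], [b]. Its displacement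
    is 0 at the ends and affine between nodes, hence largest at [t]. *)
Lemma local_time_change_shift e a t s b : a < t -> t < b -> a < s -> s < b ->
  `|s - t| <= e -> exists2 lam, local_time_change e a b lam &
    (forall u, u < t -> lam u < s) /\ (forall u, t <= u -> s <= lam u).
Proof.
move=> at_ tb as_ sb ste.
pose p := (s - a) / (t - a); pose q := (b - s) / (b - t).
have hp : (t - a) * p = s - a by rewrite /p mulrC divfK// subr_eq0 gt_eqF.
have hq : (b - t) * q = b - s by rewrite /q mulrC divfK// subr_eq0 gt_eqF.
have p0 : 0 < p by rewrite divr_gt0// subr_gt0.
have q0 : 0 < q by rewrite divr_gt0// subr_gt0.
pose lam u := if u <= a then u else if u <= t then a + (u - a) * p
  else if u <= b then b - (b - u) * q else u.
move: ste; rewrite ler_norml => /andP[st1 st2].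
have lam_t : lam t = s.
  by rewrite /lam lexx leNgt at_/= hp; lra.
have lam_lt : {homo lam : x y / x < y}.
  move=> x y xy; rewrite /lam.
  have [xa|ax] := leP x a.
    have [ya|ay] := leP y a; first lra.
    have [yt|ty] := leP y t.
      by have : 0 < (y - a) * p by [rewrite mulr_gt0// subr_gt0]; lra.
    have [yb|yb] := leP y b; last lra.
    by have : 0 < (y - t) * q by [rewrite mulr_gt0// subr_gt0]; lra.
  have [ya|_] := leP y a; first lra.
  have [xt|tx] := leP x t.
    have [yt|ty] := leP y t.
      by have : 0 < (y - x) * p by [rewrite mulr_gt0// subr_gt0]; lra.
    have H1 : 0 <= (t - x) * p by rewrite mulr_ge0 ?subr_ge0// ltW.
    have [yb|yb] := leP y b; last lra.
    by have : 0 < (y - t) * q by [rewrite mulr_gt0// subr_gt0]; lra.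
  have [yt|_] := leP y t; first lra.
  have [xb|bx] := leP x b; have [yb|yb] := leP y b; try lra.
    by have : 0 < (y - x) * q by [rewrite mulr_gt0// subr_gt0]; lra.
  by have : 0 <= (b - x) * q by [rewrite mulr_ge0 ?subr_ge0// ltW]; lra.
have lam_le : {homo lam : x y / x <= y} by exact/ltW_homo.
exists lam; last first.
  by split => u ut; rewrite -lam_t; [exact: lam_lt|exact: lam_le].
split => // [y|u|u].
- case: (leP y a) => ya; first by exists y; rewrite /lam ya.
  case: (leP y s) => ys.
    exists (a + (y - a) / p).
    have H1 : 0 < (y - a) / p by rewrite divr_gt0// subr_gt0.
    have H2 : (y - a) / p <= t - a by rewrite ler_pdivrMr// hp; lra.
    rewrite /lam ifF; last by apply/negbTE; rewrite -ltNge; lra.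
    rewrite ifT; last lra.
    by rewrite addrAC subrr add0r divfK ?gt_eqF//; lra.
  case: (leP y b) => yb; last by exists y; rewrite /lam !ifF//; apply/negbTE; rewrite -ltNge; lra.
  exists (b - (b - y) / q).
  have H1 : 0 <= (b - y) / q by rewrite divr_ge0 ?subr_ge0// ltW.
  have H2 : (b - y) / q < b - t by rewrite ltr_pdivrMr// hq; lra.
  rewrite /lam ifF; last by apply/negbTE; rewrite -ltNge; lra.
  rewrite ifF; last by apply/negbTE; rewrite -ltNge; lra.
  rewrite ifT; last lra.
  by field; rewrite gt_eqF.
- rewrite /lam => -[ua|bu]; first by rewrite ua.
  rewrite ifF; last by apply/negbTE; rewrite -ltNge; lra.
  rewrite ifF; last by apply/negbTE; rewrite -ltNge; lra.
  have [ub|//] := leP u b; have -> : u = b by lra.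
  by rewrite subrr mul0r subr0.
- have e0 : 0 <= e by lra.
  rewrite /lam; case: (leP u a) => ua; first by rewrite subrr normr0.
  case: (leP u t) => ut.
    (* The displacement is [(u - a) * (p - 1)]: the position of [p] relative to 1 fixes its sign,
       and its value at [t] is [s - t]. *)
    rewrite ler_norml; have [p1|p1] := leP 1 p.
      have H1 : 0 <= (t - u) * (p - 1) by apply: mulr_ge0; lra.
      have H2 : 0 <= (u - a) * (p - 1) by apply: mulr_ge0; lra.
      by apply/andP; split; nra.
    have H1 : 0 <= (t - u) * (1 - p) by apply: mulr_ge0; lra.
    have H2 : 0 <= (u - a) * (1 - p) by apply: mulr_ge0; lra.
    by apply/andP; split; nra.
  case: (leP u b) => ub; last by rewrite subrr normr0.
  rewrite ler_norml; have [p1|p1] := leP 1 q.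
    have H1 : 0 <= (b - u) * (q - 1) by apply: mulr_ge0; lra.
    have H2 : 0 <= (u - t) * (q - 1) by apply: mulr_ge0; lra.
    by apply/andP; split; nra.
  have H1 : 0 <= (b - u) * (1 - q) by apply: mulr_ge0; lra.
  have H2 : 0 <= (u - t) * (1 - q) by apply: mulr_ge0; lra.
  by apply/andP; split; nra.
Qed.

Lemma local_time_change_time_change e b lam : 0 <= b ->
  local_time_change e 0 b lam -> time_change lam.
Proof.
move=> b0 [l1 l2 l3 _]; split; last by move=> s t _; exact: l1.
have lam0 : lam 0 = 0 by apply: l3; left.
have lam_le : {homo lam : x y / x <= y} by exact/ltW_homo.
split.
- by move=> t; rewrite /= !in_itv/= !andbT -{2}lam0; exact: lam_le.
- move=> x y _ _ E; have [xy|yx|//] := ltgtP x y.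
    by have := l1 _ _ xy; rewrite E ltxx.
  by have := l1 _ _ yx; rewrite E ltxx.
- move=> y; rewrite /= in_itv/= andbT => y0; have [x xy] := l2 y.
  exists x => //; rewrite /= in_itv/= andbT leNgt; apply/negP => x0.
  by have := l1 _ _ x0; rewrite xy lam0 ltNge y0.
Qed.

End LocalTimeChange.

(** * The first visit to a face *)

Section FirstVisit.
Variables (R : realType) (J N : nat) (n : 'I_N -> 'rV[R]_J) (c : 'I_N -> R).
Hypothesis n1 : forall i, enorm (n i) = 1.

(** Right-continuity suffices for the infimum of the visiting times to be attained, which matters
    because [h_l] is only cadlag. *)
Lemma first_visit (h : R -> 'rV[R]_J) a v i :
  (forall t, 0 <= t -> h u @[u --> t^'+] --> h t) ->
  (forall t, 0 <= t -> polyhedron n c (h t)) ->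
  0 <= a -> a <= v -> active n c (h v) i ->
  exists s, [/\ a <= s, s <= v, active n c (h s) i &
    forall u, a <= u -> u < s -> ~ active n c (h u) i].
Proof.
move=> rc Gh a0 av hv.
pose S := [set u | a <= u /\ active n c (h u) i].
have infS : has_inf S by split; [exists v|exists a => u []].
have as_ : a <= inf S by apply: lb_le_inf; [exists v|move=> u []].
have s0 : 0 <= inf S by lra.
exists (inf S); split => //.
- by apply: ge_inf => //; case: infS.
- apply/(activeP n1 i (Gh _ s0))/eqP; rewrite eq_le; apply/andP; split; last exact: Gh.
  apply/ler_addgt0Pr => e e0.
  have J1 : 0 < (J%:R + 1) :> R by rewrite ltr_wpDl.
  have eJ := divr_gt0 e0 J1.
  have [r r0 hr] := cvg_right_dist (rc _ s0) eJ.
  have [u [au hu] ur] := inf_adherent r0 infS.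
  have su : inf S <= u by apply: ge_inf; [case: infS|].
  have u0 : 0 <= u by lra.
  have hus : `|h u - h (inf S)| <= e / (J%:R + 1).
    have [->|us] := eqVneq u (inf S); first by rewrite subrr normr0 ltW.
    by apply/ltW/hr => //; rewrite lt_neqAle eq_sym us.
  have := dot_lipschitz hus (enorm1_norm_le (n1 i)).
  have : J%:R * (e / (J%:R + 1)) <= e.
    by rewrite mulrA ler_pdivrMr// mulrC (ler_wpM2l (ltW e0))// lerDl.
  move/(activeP n1 i (Gh u u0)): hu => ->.
  by rewrite ler_norml => H1 /andP[H2 H3]; lra.
- move=> u au us hu; have : inf S <= u by apply: ge_inf; [case: infS|].
  by rewrite leNgt us.
Qed.

End FirstVisit.

(** * The jump competitor along [h_l] and the tracking of [phi] *)

Section Tracking.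
Variables (R : realType) (J N : nat) (n : 'I_N -> 'rV[R]_J) (c : 'I_N -> R).
Hypothesis n1 : forall i, enorm (n i) = 1.
Variable d : 'I_N -> 'rV[R]_J.
Hypothesis hdn : forall i, dot (d i) (n i) = 1.
Hypothesis A2 : assumption_A2 n d.
Variables (h g psi phi eta : R -> 'rV[R]_J).
Hypotheses (jit : boundary_jitter n c h g)
  (cpsi : cpath psi) (psi0 : active_hyperplanes n c (h 0) (psi 0))
  (D : solves_derivative_problem n c d h psi phi eta).
Variables (f_ h_ g_ : nat -> R -> 'rV[R]_J).
Hypotheses (ESP_ : forall l, solves_ESP n c d (f_ l) (h_ l) (g_ l))
  (hl : locally_uniform h_ h) (gl : locally_uniform g_ g).

Let ch : cpath h. Proof. by have [[]] := jit. Qed.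
Let Gh t : 0 <= t -> polyhedron n c (h t).
Proof. by have [[_ + _] _] := jit; apply. Qed.
Let Gh_ l t : 0 <= t -> polyhedron n c (h_ l t).
Proof. by have [_ [_ + _ _]] := ESP_ l; apply. Qed.
Let g_inc l s t : 0 <= s -> s < t ->
  conic_hull (\bigcup_(u in `]s, t]%classic) dcone n c d (h_ l u)) (g_ l t - g_ l s).
Proof. by have [_ [_ _ + _]] := ESP_ l; apply. Qed.

(* [etabar = eta a + pushes es] jumps only in directions that are admissible for
   [h_ l], so it can be compared with the constraining term of the derivative
   problem along [h_ l]; up to [K] it satisfies the constraints of that problem
   and agrees with [phi - psi] after the time change. *)
Definition tracked (e K : R) l a b (es : seq (R * 'I_N * R)) (lam : R -> R) :=
  [/\ forall x, x \in es -> [/\ a < x.1.1, x.1.1 <= b & active n c (h_ l x.1.1) x.1.2],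
      pushes d es b = eta b - eta a,
      local_time_change e a b lam,
      forall u, a <= u -> u <= b ->
        `|psi (lam u) + (eta a + pushes d es (lam u)) - phi u| <= K
    & forall u i, a <= u -> u <= b -> active n c (h_ l u) i ->
        `|dot (psi u + (eta a + pushes d es u)) (n i)| <= K].

Definition trackable e K a b :=
  \forall l \near \oo, exists es lam, tracked e K l a b es lam.

(** After [y] the first list contributes exactly [eta y - eta x], so the second piece sees its own
    base value [eta y], and [K] does not grow. *)
Lemma trackable_trans e K x y z : x <= y -> y <= z ->
  trackable e K x y -> trackable e K y z -> trackable e K x z.
Proof.
move=> xy yz Txy Tyz; near=> l.
have [es1 [lam1 [v1 p1 t1 c1 k1]]] :
  exists es lam, tracked e K l x y es lam by near: l.
have [es2 [lam2 [v2 p2 t2 c2 k2]]] :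
  exists es lam, tracked e K l y z es lam by near: l.
have P1 u : y <= u -> pushes d es1 u = eta y - eta x.
  move=> yu; rewrite -p1; apply: pushes_const => ev /v1[_ evy _].
  by rewrite evy (le_trans evy).
have P2 u : u <= y -> pushes d es2 u = 0.
  by move=> uy; apply: pushes_lt => ev /v2[yev _ _]; lra.
have etaD v : eta x + (eta y - eta x + v) = eta y + v.
  by rewrite addrA (addrC (eta x)) subrK.
have [_ _ id1 _] := t1; have [_ _ id2 _] := t2.
exists (es1 ++ es2), (lam1 \o lam2); split.
- move=> ev; rewrite mem_cat => /orP[/v1[]|/v2[]]; split => //; lra.
- by rewrite pushes_cat P1// p2 addrC addrA subrK.
- exact: local_time_change_comp t1 t2.
- move=> u xu uz; rewrite pushes_cat /=.
  have [uy|/ltW yu] := leP u y.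
    rewrite id2; last by left.
    have [_ lamy] := local_time_change_itv t1 xu uy.
    by rewrite (P2 (lam1 u))// addr0; exact: c1.
  have [ylam _] := local_time_change_itv t2 yu uz.
  rewrite id1; last by right.
  by rewrite P1// etaD; exact: c2.
- move=> u i xu uz ai; rewrite pushes_cat.
  have [uy|/ltW yu] := leP u y; first by rewrite P2// addr0; exact: k1.
  by rewrite P1// etaD; exact: k2.
Unshelve. all: by end_near. Qed.

Lemma trackable0 e K : 0 <= e -> 0 <= K -> trackable e K 0 0.
Proof.
move=> e0 K0.
have na : \forall l \near \oo, forall i, ~ active n c (h 0) i ->
    forall t, 0 <= t -> t <= 0 -> ~ active n c (h_ l t) i.
  apply: filter_forall => i; have [ai|ai] := pselect (active n c (h 0) i).
    by near=> l.
  have H t : 0 <= t -> t <= 0 -> ~ active n c (h t) i.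
    by move=> t0 t0'; have -> : t = 0 by lra.
  by apply: filterS (inactive_approx n1 ch Gh Gh_ hl (lexx 0) (lexx 0) H) => l Hl _.
have eta00 := eta0 hdn A2 D psi0.
near=> l; have nal : forall i, ~ active n c (h 0) i ->
  forall t, 0 <= t -> t <= 0 -> ~ active n c (h_ l t) i by near: l.
exists [::], id; split => //.
- by rewrite subrr /pushes big_nil.
- exact: local_time_change_id.
- move=> u u0 u0'; have -> : u = 0 by lra.
  have [_ [phiE _ _ _]] := D.
  by rewrite /pushes big_nil addr0 -phiE// subrr normr0.
- move=> u i u0 u0'; have {u u0 u0'} -> : u = 0 by lra.
  rewrite /pushes big_nil addr0 eta00 addr0 => ai.
  have ai0 : active n c (h 0) i.
    by apply: contrapT => /nal /(_ 0 (lexx _) (lexx _)).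
  by rewrite (psi0 ai0) normr0.
Unshelve. all: by end_near. Qed.

Lemma eta_increment (I : {set 'I_N}) a b : 0 <= a -> a < b ->
  (forall u i, a < u -> u <= b -> active n c (h u) i -> i \in I) ->
  (eta b - eta a <= \matrix_(i < N) (if i \in I then d i else 0))%MS.
Proof.
move=> a0 ab HI; have [_ [_ _ inc _]] := D.
apply: linear_span_submx (inc a b a0 ab) => y [u /=].
rewrite in_itv/= => /andP[au ub]; apply: conic_hull_submx => _ [i ai <-].
have -> : d i = row i (\matrix_(i < N) (if i \in I then d i else 0)).
  by rewrite rowK (HI u i).
exact: row_sub.
Qed.

Lemma eta_increment_norm e a b : 0 <= a -> a <= b ->
  `|phi b - phi a| <= e -> `|psi b - psi a| <= e -> `|eta b - eta a| <= 2 * e.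
Proof.
move=> a0 ab H1 H2; have [_ [phiE _ _ _]] := D.
have b0 : 0 <= b by lra.
have -> : eta b - eta a = (phi b - phi a) - (psi b - psi a).
  by rewrite !phiE// opprD addrACA [RHS]addrC addKr.
by apply: le_trans (ler_normB _ _) _; lra.
Qed.


Let phiE t : 0 <= t -> phi t = psi t + eta t.
Proof. by have [_ [+ _ _ _]] := D; apply. Qed.
Let eta00 : eta 0 = 0. Proof. exact: (eta0 hdn A2 D psi0). Qed.
Let Hphi t i : 0 <= t -> active n c (h t) i -> dot (phi t) (n i) = 0.
Proof. by have [_ [_ + _ _]] := D => /[apply] H /H. Qed.

Lemma near_increment a (v P w : 'rV[R]_J) (e1 e2 e3 : R) : 0 <= a ->
  `|v - psi a| <= e1 -> `|phi a - w| <= e2 -> `|P| <= e3 ->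
  `|v + (eta a + P) - w| <= e1 + e2 + e3.
Proof.
move=> a0 H1 H2 H3.
have -> : v + (eta a + P) - w = (v - psi a) + (phi a - w) + P.
  by rewrite phiE// !addrA subrK; exact: addrAC.
apply: le_trans (ler_normD _ _) _; rewrite lerD//.
by apply: le_trans (ler_normD _ _) _; rewrite lerD.
Qed.

Lemma dot_near_hyperplane v w i e : dot w (n i) = 0 -> `|v - w| <= e ->
  `|dot v (n i)| <= J%:R * e.
Proof.
move=> w0 vw; have := dot_lipschitz vw (enorm1_norm_le (n1 i)).
by rewrite w0 subr0.
Qed.

(** When [phi] oscillates little, the order of the jumps is immaterial: any partial sum of them is
    of order [e]. Each visited face gets one jump, at any time when [h_l] is on it. If [h_l] is on a
    face at [u], then [h] is on it somewhere in the piece, and [phi] there is close to the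
    competitor at [u]. *)
Lemma trackable_normal e C K a b : 0 < e -> push_constant d C ->
  (J%:R + 1) * (2 * C * (\sum_i `|d i|) + 4) * e <= K -> 0 <= a -> a < b ->
  (forall i, ~ active n c (h b) i) ->
  (forall u, a <= u -> u <= b -> `|phi u - phi a| <= e) ->
  (forall u, a <= u -> u <= b -> `|psi u - psi a| <= e) ->
  trackable e K a b.
Proof.
move=> e0 [C0 HC] HK a0 ab nb ophi opsi.
pose W := 2 * C * (\sum_i `|d i|).
have W0 : 0 <= W by rewrite !mulr_ge0// sumr_ge0.
have We0 : 0 <= W * e by rewrite mulr_ge0// ltW.
have Je0 : 0 <= J%:R * e by rewrite mulr_ge0// ltW.
have JWe0 : 0 <= J%:R * (W * e) by rewrite mulr_ge0.
have b0 : 0 <= b by lra.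
have [[_ _ _] [jit1 jit2 jit3 _]] := jit.
pose I : {set 'I_N} := [set i | `[< exists u, [/\ a < u, u <= b & active n c (h u) i] >]]%SET.
have etaI : (eta b - eta a <= \matrix_(i < N) (if i \in I then d i else 0))%MS.
  apply: eta_increment => // u i au ub ai; rewrite inE; apply/asboolP.
  by exists u.
have [r etaE hr] := HC I _ etaI.
have eta_le : `|eta b - eta a| <= 2 * e.
  by apply: eta_increment_norm => //; [exact: ltW|apply: ophi|apply: opsi]; rewrite ?lexx ?ltW.
have rle i : `|r i| <= 2 * C * e.
  apply: le_trans (hr i) _; apply: le_trans (ler_wpM2l C0 eta_le) _.
  by rewrite mulrCA mulrA.
have visits : \forall l \near \oo, forall i, i \in I ->
    exists v, [/\ a < v, v <= b & active n c (h_ l v) i].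
  apply: filter_forall => i; have [iI|iI] := boolP (i \in I); last by near=> l.
  move: (iI); rewrite inE => /asboolP[u [au ub ai]].
  (* A visit strictly before [b] leaves room for the nearby visit of [h_l]. *)
  have {}ub : u < b.
    rewrite lt_neqAle ub andbT; apply/eqP => ub'.
    by apply: (nb i); rewrite -ub'.
  have [s [s0 as_ sb si]] :
      exists s, [/\ 0 < s, a < s, s < b & active n c (h s) = [set i]].
    have u0 : 0 < u by lra.
    have ua0 : 0 < u - a by lra.
    have [ui|[s [s0 s1 s2 si]]] := single_active_time jit3 u0 ai ua0.
      by exists u.
    by exists s; split => //; lra.
  pose q := Num.min (s - a) (b - s).
  have q0 : 0 < q by rewrite lt_min !subr_gt0 as_.
  have q1 : q <= s - a by rewrite ge_min lexx.
  have q2 : q <= b - s by rewrite ge_min lexx orbT.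
  have sbd : boundary (polyhedron n c) (h s).
    by have : active n c (h s) i by [rewrite si]; case.
  have H := hit_approx n1 ch Gh Gh_ hl gl g_inc (jit1 s (ltW s0) sbd) s0 si q0.
  apply: filterS H => l [v [v0 v1 v2 av]] _.
  by exists v; split => //; lra.
have close : \forall l \near \oo, forall i,
    (exists u, [/\ a <= u, u <= b & active n c (h u) i]) \/
    forall u, a <= u -> u <= b -> ~ active n c (h_ l u) i.
  apply: filter_forall => i.
  have [ex|nex] := pselect (exists u, [/\ a <= u, u <= b & active n c (h u) i]).
    by near=> l; left.
  have nex' u : a <= u -> u <= b -> ~ active n c (h u) i.
    by move=> au ub ai; apply: nex; exists u.
  by apply: filterS (inactive_approx n1 ch Gh Gh_ hl a0 (ltW ab) nex') => l Hl; right.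
near=> l.
have visl : forall i, i \in I ->
    exists v, [/\ a < v, v <= b & active n c (h_ l v) i] by near: l.
have clol : forall i,
    (exists u, [/\ a <= u, u <= b & active n c (h u) i]) \/
    forall u, a <= u -> u <= b -> ~ active n c (h_ l u) i by near: l.
have /choice[v vP] : forall i, exists x : R, i \in I ->
    [/\ a < x, x <= b & active n c (h_ l x) i].
  move=> i; have [/visl[x xP]|iI] := boolP (i \in I); first by exists x.
  by exists 0.
pose es := [seq (v i, i, r i) | i <- enum I].
have pushE u : pushes d es u = \sum_(i in I | v i <= u) r i *: d i.
  by rewrite /pushes big_map /= big_enum_cond.
have push_le u : `|pushes d es u| <= W * e.
  rewrite pushE; apply: le_trans (ler_norm_sum _ _ _) _.
  have -> : W * e = \sum_i 2 * C * e * `|d i| by rewrite -mulr_sumr /W; ring.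
  rewrite big_mkcond; apply: ler_sum => i _.
  case: ifP => _; first by rewrite normrZ ler_wpM2r.
  by rewrite mulr_ge0//; apply: le_trans (rle i).
exists es, id; split.
- by move=> x /mapP[i]; rewrite mem_enum => /vP ? ->.
- rewrite pushE etaE; apply: eq_bigl => i.
  by have [/vP[_ -> _]|//] := boolP (i \in I).
- exact/local_time_change_id/ltW.
- move=> u au ub /=.
  have := near_increment a0 (opsi u au ub) _ (push_le u).
  move=> /(_ (phi u) e); rewrite distrC => /(_ (ophi u au ub)) /le_trans; apply.
  by apply: le_trans HK; rewrite -/W; nra.
- move=> u i au ub ai.
  have [[u' [au' ub' ai']]|/(_ u au ub)//] := clol i.
  have u'0 : 0 <= u' by lra.
  have := near_increment a0 (opsi u au ub) _ (push_le u).
  move=> /(_ (phi u') e); rewrite distrC => /(_ (ophi u' au' ub')) H.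
  apply: le_trans (dot_near_hyperplane (Hphi u'0 ai') H) _.
  by apply: le_trans HK; rewrite -/W; nra.
Unshelve. all: by end_near. Qed.

(** Only face [i] is met, and only from [t] on, so the increment of [eta] is a multiple of [d i] and
    can be one jump. Aligning it with [t] by the time change matches the jump of [phi], which is not
    small. *)
Lemma trackable_jump e C K a t b i : 0 < e -> push_constant d C ->
  (J%:R + 1) * 4 * e <= K -> 0 <= a -> a < t -> t < b ->
  active n c (h t) = [set i] ->
  (forall u, a <= u -> u < t -> forall j, ~ active n c (h u) j) ->
  (forall u, t <= u -> u <= b -> forall j, active n c (h u) j -> j = i) ->
  (forall u, a <= u -> u < t -> `|phi u - phi a| <= e) ->
  (forall u, t <= u -> u <= b -> `|phi u - phi t| <= e) ->
  (forall u, a <= u -> u <= b -> `|psi u - psi a| <= e) ->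
  trackable e K a b.
Proof.
move=> e0 [C0 HC] HK a0 at_ tb ti nat_ itb ophi1 ophi2 opsi.
have Je0 : 0 <= J%:R * e by rewrite mulr_ge0// ltW.
have t0 : 0 < t by lra.
have ab : a < b by lra.
have b0 : 0 <= b by lra.
have [_ [jit1 _ _ _]] := jit.
have nai u j : a <= u -> u <= b -> active n c (h u) j -> t <= u /\ j = i.
  move=> au ub aj; have [ut|tu] := ltP u t; first by case: (nat_ u au ut j).
  by split => //; exact: itb aj.
have [r etaE _] : exists2 r : 'I_N -> R, eta b - eta a = \sum_(k in [set i]%SET) r k *: d k &
    forall k, `|r k| <= C * `|eta b - eta a|.
  apply: HC; apply: eta_increment => // u j au ub aj.
  by rewrite inE; have [_ ->] := nai u j (ltW au) ub aj.
rewrite big_set1 in etaE.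
pose q := Num.min (Num.min e ((t - a) / 2)) ((b - t) / 2).
have q1 : q <= e by rewrite !ge_min lexx.
have q2 : q <= (t - a) / 2 by rewrite !ge_min lexx orbT.
have q3 : q <= (b - t) / 2 by rewrite ge_min lexx orbT.
have q0 : 0 < q by rewrite !lt_min e0/=; apply/andP; split; lra.
have N1 : \forall l \near \oo, forall j u, a <= u -> u <= t - q ->
    ~ active n c (h_ l u) j.
  apply: filter_forall => j.
  have H u : a <= u -> u <= t - q -> ~ active n c (h u) j.
    by move=> au ut; apply: nat_ => //; lra.
  have atq : a <= t - q by lra.
  by apply: filterS (inactive_approx n1 ch Gh Gh_ hl a0 atq H) => l Hl.
have N2 : \forall l \near \oo, forall j, j != i -> forall u, a <= u -> u <= b ->
    ~ active n c (h_ l u) j.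
  apply: filter_forall => j; have [->|ji] := eqVneq j i; first by near=> l.
  have H u : a <= u -> u <= b -> ~ active n c (h u) j.
    by move=> au ub /(nai u j au ub)[_ /eqP]; rewrite (negbTE ji).
  by apply: filterS (inactive_approx n1 ch Gh Gh_ hl a0 (ltW ab) H) => l Hl _.
have tbd : boundary (polyhedron n c) (h t).
  by have : active n c (h t) i by [rewrite ti]; case.
have N3 := hit_approx n1 ch Gh Gh_ hl gl g_inc (jit1 t (ltW t0) tbd) t0 ti q0.
near=> l.
have N1l : forall j u, a <= u -> u <= t - q -> ~ active n c (h_ l u) j by near: l.
have N2l : forall j, j != i -> forall u, a <= u -> u <= b ->
    ~ active n c (h_ l u) j by near: l.
have [v [v0 v1 v2 av]] : exists v,
  [/\ 0 < v, t - q < v, v < t + q & active n c (h_ l v) i] by near: l.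
have rcl u : 0 <= u -> h_ l w @[w --> u^'+] --> h_ l u.
  by have [[[+ _] _ _] _] := ESP_ l; apply.
have av' : a <= v by lra.
(* An arbitrary visit would not do: at a visit before the jump the competitor would violate the
   constraint of face [i]. *)
have [s [as_ sv ai fst]] := first_visit n1 rcl (Gh_ l) a0 av' av.
have sq : t - q < s by rewrite ltNge; apply/negP => /(N1l i s as_); apply.
have st : `|s - t| <= e by rewrite ler_norml; apply/andP; split; lra.
have as' : a < s by lra.
have sb : s < b by lra.
have [lam lamP [lam1 lam2]] := local_time_change_shift at_ tb as' sb st.
pose es : seq (R * 'I_N * R) := [:: (s, i, r i)].
have push0 u : u < s -> pushes d es u = 0.
  by move=> us; apply: pushes_lt => x; rewrite inE => /eqP ->.
have push1 u : s <= u -> pushes d es u = eta b - eta a.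
  by move=> su; rewrite /pushes big_cons big_nil /= su addr0 etaE.
(* From the jump on, the competitor is read as based at [b] with no push, the form expected by
   [near_increment]. *)
have etaK : eta a + (eta b - eta a) = eta b + 0 by rewrite addr0 addrC subrK.
have opsib u : a <= u -> u <= b -> `|psi u - psi b| <= e + e.
  move=> au ub; have -> : psi u - psi b = (psi u - psi a) - (psi b - psi a).
    by rewrite opprB addrA subrK.
  by apply: le_trans (ler_normB _ _) _; apply: lerD; apply: opsi => //; exact: ltW.
have n0 : `|0 : 'rV[R]_J| <= 0 by rewrite normr0.
have ophib : `|phi b - phi t| <= e by apply: ophi2 => //; exact: ltW.
exists es, lam; split => //.
- by move=> x; rewrite inE => /eqP -> /=; split => //; exact: ltW.
- by rewrite push1//; exact: ltW.
- move=> u au ub; have [alam lamb] := local_time_change_itv lamP au ub.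
  have [ut|tu] := ltP u t.
    rewrite (push0 _ (lam1 u ut)).
    have H : `|phi a - phi u| <= e by rewrite distrC ophi1.
    apply: le_trans (near_increment a0 (opsi _ alam lamb) H n0) _; nra.
  rewrite (push1 _ (lam2 u tu)) etaK.
  have H : `|phi b - phi u| <= e + e.
    have -> : phi b - phi u = (phi b - phi t) - (phi u - phi t).
      by rewrite opprB addrA subrK.
    by apply: le_trans (ler_normB _ _) _; apply: lerD => //; apply: ophi2.
  apply: le_trans (near_increment b0 (opsib _ alam lamb) H n0) _; nra.
- move=> u j au ub aj.
  have ji : j = i by apply: contrapT => /eqP /N2l /(_ u au ub); apply.
  rewrite ji in aj *.
  have su : s <= u by rewrite leNgt; apply/negP => /(fst u au); apply.
  rewrite (push1 _ su) etaK.
  have ait : active n c (h t) i by rewrite ti.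
  have H := near_increment b0 (opsib _ au ub) ophib n0.
  apply: le_trans (dot_near_hyperplane (Hphi (ltW t0) ait) H) _; nra.
Unshelve. all: by end_near. Qed.

(** Three cases: the start, where only the right limit matters; times where [phi] is
    left-continuous; and jump times, described by [jump_dichotomy]. *)
Lemma trackable_local e C K t : 0 < e -> push_constant d C ->
  (J%:R + 1) * (2 * C * (\sum_i `|d i|) + 4) * e <= K -> 0 <= t ->
  exists2 r, 0 < r & forall a b, 0 <= a ->
    a = 0 \/ (forall i, ~ active n c (h a) i) ->
    t - r < a -> a <= t -> t < b -> b < t + r ->
    (forall i, ~ active n c (h b) i) -> trackable e K a b.
Proof.
move=> e0 HC HK t0; have e2 : 0 < e / 2 by lra.
have S0 : 0 <= 2 * C * (\sum_i `|d i|) by rewrite !mulr_ge0// ?sumr_ge0//; case: HC.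
have HK4 : (J%:R + 1) * 4 * e <= K.
  apply: le_trans HK; apply: ler_wpM2r; first exact: ltW.
  by apply: ler_wpM2l; [rewrite addr_ge0|rewrite lerDr].
have [[cphi _ _] _] := D.
have [_ [_ _ jit3 _]] := jit.
have osc (f0 : R -> 'rV[R]_J) x y w : `|f0 x - w| < e / 2 -> `|f0 y - w| < e / 2 ->
    `|f0 x - f0 y| <= e.
  move=> H1 H2; have -> : f0 x - f0 y = (f0 x - w) - (f0 y - w).
    by rewrite opprB addrA subrK.
  by apply: le_trans (ler_normB _ _) _; lra.
have [r1 r10 h1] := path_continuous cpsi t0 e2.
have opsi a b : 0 <= a -> t - r1 < a -> a <= t -> b < t + r1 ->
    forall u, a <= u -> u <= b -> `|psi u - psi a| <= e.
  move=> a0 ra a_t br u au ub.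
  by apply: (osc psi u a (psi t)); apply: h1; lra.
have [r2 r20 h2'] := cvg_right_dist (proj1 cphi t t0) e2.
have h2 u : t <= u -> u < t + r2 -> `|phi u - phi t| < e / 2.
  move=> tu ur; have [->|ut] := eqVneq u t; first by rewrite subrr normr0.
  by apply: h2' => //; rewrite lt_neqAle eq_sym ut.
have [t_eq0|t_neq0] := eqVneq t 0.
  exists (Num.min r1 r2); first by rewrite lt_min r10.
  have m1 : Num.min r1 r2 <= r1 by rewrite ge_min lexx.
  have m2 : Num.min r1 r2 <= r2 by rewrite ge_min lexx orbT.
  move=> a b a0 _ ra a_t tb br nb; apply: (trackable_normal e0 HC HK) => //; first lra.
    by move=> u au ub; apply: (osc phi u a (phi t)); apply: h2; lra.
  by apply: opsi => //; lra.
have {}t_neq0 : 0 < t by rewrite lt_neqAle eq_sym t_neq0.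
have [cvgl|[i ti [r3 r30 nat_]]] := jump_dichotomy n1 hdn A2 ch Gh cpsi D jit3 t_neq0.
  have [r3 r30 h3] := cvg_left_dist cvgl e2.
  exists (Num.min r1 (Num.min r2 r3)); first by rewrite !lt_min r10 r20.
  have m1 : Num.min r1 (Num.min r2 r3) <= r1 by rewrite !ge_min lexx.
  have m2 : Num.min r1 (Num.min r2 r3) <= r2 by rewrite !ge_min lexx orbT.
  have m3 : Num.min r1 (Num.min r2 r3) <= r3 by rewrite !ge_min lexx !orbT.
  have h23 u : t - r3 < u -> u < t + r2 -> `|phi u - phi t| < e / 2.
    by move=> ur ur'; have [ut|tu] := ltP u t; [apply: h3|apply: h2].
  move=> a b a0 _ ra a_t tb br nb; apply: (trackable_normal e0 HC HK) => //; first lra.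
    by move=> u au ub; apply: (osc phi u a (phi t)); apply: h23; lra.
  by apply: opsi => //; lra.
have [r4 r40 h4] := active_usc n1 ch Gh t0.
have [r5 r50 h5] := cvg_left_dist (proj2 cphi t t_neq0) e2.
pose q := Num.min (Num.min r1 r2) (Num.min r3 (Num.min r4 r5)).
have q1 : q <= r1 by rewrite !ge_min lexx.
have q2 : q <= r2 by rewrite !ge_min lexx orbT.
have q3 : q <= r3 by rewrite !ge_min lexx orbT.
have q4 : q <= r4 by rewrite !ge_min lexx !orbT.
have q5 : q <= r5 by rewrite !ge_min lexx !orbT.
exists q; first by rewrite !lt_min r10 r20 r30 r40.
move=> a b a0 ga ra a_t tb br nb.
(* The left end is 0 or an interior time, whereas face [i] is active at the positive time [t]. *)
have at_ : a < t.
  rewrite lt_neqAle a_t andbT; apply/eqP => E; case: ga => [a00|/(_ i)].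
    by move: t_neq0; rewrite -E a00 ltxx.
  by rewrite E ti; apply.
apply: (trackable_jump e0 HC HK4 a0 at_ tb ti).
- by move=> u au ut j; apply: nat_ => //; lra.
- move=> u tu ub j aj; have : active n c (h t) j.
    by apply: (h4 u _ _ j aj); [lra|rewrite ltr_distl; apply/andP; split; lra].
  by rewrite ti.
- move=> u au ut; apply: (osc phi u a (left_limit phi t)); apply: h5; lra.
- by move=> u tu ub; apply: le_trans (ltW (h2 u tu _)) _; lra.
- by apply: opsi => //; lra.
Qed.

(** A supremum argument over endpoints that are 0 or interior times, the only ones from which a
    piece may start. The time set on the boundary being null, an interior time exists just past the
    supremum. *)
Lemma trackable_unbounded e C K T : 0 < e -> push_constant d C ->
  (J%:R + 1) * (2 * C * (\sum_i `|d i|) + 4) * e <= K ->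
  exists2 b, T < b /\ 0 <= b & trackable e K 0 b.
Proof.
move=> e0 HC HK.
have S0 : 0 <= 2 * C * (\sum_i `|d i|) by rewrite !mulr_ge0// ?sumr_ge0//; case: HC.
have K0 : 0 <= K.
  by apply: le_trans HK; rewrite !mulr_ge0// ?addr_ge0// ltW.
pose S := [set b | [/\ 0 <= b, b = 0 \/ (forall i, ~ active n c (h b) i)
  & trackable e K 0 b]].
have S00 : S 0 by split; [exact: lexx|left|apply: trackable0 => //; exact: ltW].
apply: contrapT => nT.
have supS : has_sup S.
  split; [by exists 0|exists (Num.max T 0) => b [b0 _ Tb]].
  rewrite le_max leNgt; case: ltP => //= Tb'.
  by exfalso; apply: nT; exists b.
have s0 : 0 <= sup S by apply: ub_le_sup => //; case: supS.
have [r r0 hr] := trackable_local e0 HC HK s0.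
have [a [a0 ga Ta] ra] := sup_adherent r0 supS.
have as_ : a <= sup S by apply: ub_le_sup => //; case: supS.
have [_ [_ jit2 _ _]] := jit.
have sr : sup S < sup S + r by lra.
have [b [sb br nb]] := inactive_time ch jit2 s0 sr.
have : S b.
  split; [lra|by right|apply: (trackable_trans a0 _ Ta (hr a b a0 ga ra as_ sb br nb)); lra].
move=> /(ub_le_sup (proj2 supS)); lra.
Qed.

Variables (psi_ phi_ eta_ : nat -> R -> 'rV[R]_J).
Hypotheses (D_ : forall l, solves_derivative_problem n c d (h_ l) (psi_ l) (phi_ l) (eta_ l))
  (psil : locally_uniform psi_ psi).

(** Spans replace cones, so the moves of both terms have either sign, and [up] and [down] are the
    same relation: activity for [h_l]. The normal components agree there because [phi_l] satisfies
    the constraint exactly and the competitor up to [K]. *)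
Lemma tracked_eta_bound (p : 'rV[R]_J -> R) mu k C' e e1 K l b es lam :
  0 < k -> 0 < C' ->
  (forall z, `|z| <= C' * p z) -> (forall z, dot (mu z) z = p z) ->
  (forall z y, dot (mu z) y <= p y) ->
  (forall i z, 0 < p z -> dot z (n i) < k * p z -> dot (mu z) (d i) <= 0) ->
  (forall i z, 0 < p z -> - (k * p z) < dot z (n i) -> 0 <= dot (mu z) (d i)) ->
  0 <= e1 -> 0 < K -> 0 <= b -> tracked e K l 0 b es lam ->
  (forall t, 0 <= t -> t <= b -> `|psi_ l t - psi t| < e1) ->
  forall t, 0 <= t -> t <= b ->
  `|eta_ l t - pushes d es t| <= C' * (3 * (J%:R * e1 + K) / k).
Proof.
move=> k0 C0 Cp mu_p mu_le mu1 mu2 e10 K0 b0 [v _ _ _ ck] Hpsi t t0 tb.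
have [[_ [rc ll] eta_0] [phi_E Hphi_ inc jump]] := D_ l.
apply: le_trans (Cp _) _; apply: ler_wpM2l; first exact: ltW.
have n1' i : `|n i| <= 1 by exact: enorm1_norm_le.
have bound i u : 0 <= u -> u <= b -> active n c (h_ l u) i ->
    `|dot (eta_ l u - pushes d es u) (n i)| <= J%:R * e1 + K.
  move=> u0 ub ai; have := ck u i u0 ub ai; rewrite eta00 add0r.
  have := dot_lipschitz (ltW (Hpsi u u0 ub)) (n1' i).
  have := Hphi_ u u0 i ai; rewrite /= phi_E// !dotDl dotNl => E.
  rewrite !ler_norml => /andP[a1 a2] /andP[a3 a4]; apply/andP; split; lra.
have adm u L : admissible d (fun i u => active n c (h_ l u) i)
    (fun i u => active n c (h_ l u) i) u L ->
    forall i, active n c (h_ l u) i -> dot L (d i) = 0.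
  move=> HL i ai; apply/eqP; rewrite eq_le (HL i).1//=; exact: (HL i).2.
apply: (@gauge_bound _ _ _ n d n1' p mu k k0 mu_p mu_le mu1 mu2
  (fun t => eta_ l t - pushes d es t) b _ (fun i u => active n c (h_ l u) i)
  (fun i u => active n c (h_ l u) i)) => //.
- by rewrite ltr_wpDl// mulr_ge0.
- by move=> u u0; apply: cvgB; [exact: rc|exact: pushes_right_continuous].
- move=> u u0 ub; have [s su [pl hs]] := pushes_left_limit d es u.
  exists (left_limit (eta_ l) u - pushes d es s).
    by apply: cvgB; [exact: ll|].
  move=> L /adm HL.
  have E1 : dot L (eta_ l u - left_limit (eta_ l) u) = 0.
    by apply: linear_span_eq0 (jump u u0) => y; exact: dcone_eq0.
  have E2 : dot L (pushes d es u - pushes d es s) = 0.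
    apply: pushes_dot => [|x xes sx xu]; first exact: ltW.
    have xE : x.1.1 = u by apply/eqP; rewrite eq_le xu hs.
    by apply: HL; have [_ _] := v x xes; rewrite xE.
  by move: E1 E2; rewrite !dotBr; lra.
- move=> s u s0 su ub L HL.
  have E1 : dot L (eta_ l u - eta_ l s) = 0.
    apply: linear_span_eq0 (inc s u s0 su) => y [w /=]; rewrite in_itv/= => /andP[sw wu].
    by apply: dcone_eq0; apply: adm; exact: HL.
  have E2 : dot L (pushes d es u - pushes d es s) = 0.
    apply: pushes_dot => [|x xes sx xu]; first exact: ltW.
    by apply: (adm x.1.1); [exact: HL|have [_ _] := v x xes].
  by move: E1 E2; rewrite !dotBr; lra.
- move=> L /adm HL; rewrite pushes_lt ?subr0; last by move=> x /v[].
  by rewrite (linear_span_eq0 _ eta_0)// => y; exact: dcone_eq0.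
- by move=> i u u0 ub ai; have := bound i u u0 ub ai; rewrite ler_norml => /andP[].
- by move=> i u u0 ub ai; have := bound i u u0 ub ai; rewrite ler_norml => /andP[].
Qed.

(** The data and the constraining terms are compared at the same time [lam t]; only the competitor
    links [lam t] to [t]. *)
Lemma derivative_tracking T e : 0 < e -> \forall l \near \oo,
  exists lam, [/\ time_change lam, forall t, 0 <= t -> `|lam t - t| < e &
    forall t, 0 <= t -> t <= T -> `|phi_ l (lam t) - phi t| < e].
Proof.
move=> e0.
have [C HC] := push_constant_exists d; have C0 := HC.1.
have [p [mu [k [C' [k0 C'0 Cp _ [mu_p mu_le mu1 mu2]]]]]] := A2_gauge hdn A2.
(* The sum bounds the jumps of a normal piece, 4 the oscillations of [psi] and [phi] around a jump
   piece. The factor [J + 1] covers both the norm and the product with [n i], which is [J]-Lipschitz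
   for the maximum norm. *)
pose W := (J%:R + 1) * (2 * C * (\sum_i `|d i|) + 4).
have W0 : 0 < W.
  have S0 : 0 <= 2 * C * (\sum_i `|d i|) by rewrite !mulr_ge0// sumr_ge0.
  by rewrite mulr_gt0// ltr_wpDl.
(* One term per error: [psi_l] against [psi], competitor against [phi], and [eta_l] against the
   jumps. *)
pose M := 1 + W + C' * (3 * (J%:R + W) / k).
have M1 : 1 <= M.
  rewrite /M -addrA lerDl; apply: addr_ge0; first exact: ltW.
  apply: mulr_ge0; first exact: ltW.
  apply: divr_ge0; last exact: ltW.
  by apply: mulr_ge0 => //; apply: addr_ge0 => //; exact: ltW.
pose e1 := e / (2 * M).
have e1M : M * e1 = e / 2 by rewrite /e1; field; rewrite gt_eqF//; lra.
have e10 : 0 < e1 by rewrite divr_gt0// mulr_gt0//; lra.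
have e1e : e1 < e by nra.
have [b [Tb b0] Hb] := trackable_unbounded T e10 HC (lexx (W * e1)).
near=> l.
have [es [lam trk]] : exists es lam, tracked e1 (W * e1) l 0 b es lam by near: l.
have Hpsi : forall t, 0 <= t -> t <= b -> `|psi_ l t - psi t| < e1.
  by near: l; exact: psil.
have WE0 : 0 < W * e1 by rewrite mulr_gt0.
have Heta := tracked_eta_bound k0 C'0 Cp mu_p mu_le mu1 mu2 (ltW e10) WE0 b0 trk Hpsi.
have [_ _ ltc cl _] := trk.
have [_ _ _ lame] := ltc.
exists lam; split.
- exact: local_time_change_time_change ltc.
- by move=> t t0; apply: le_lt_trans (lame t) _.
- move=> t t0 tT; have tb : t <= b by lra.
  have [lt0 ltb] := local_time_change_itv ltc t0 tb.
  have [_ [phi_E _ _ _]] := D_ l.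
  have := cl t t0 tb; have := Heta _ lt0 ltb; have := Hpsi _ lt0 ltb.
  rewrite eta00 add0r phi_E//; set x := psi_ l _; set y := psi _; set z := eta_ l _.
  set w := pushes _ _ _; set v := phi t => H1 H2 H3.
  have -> : x + z - v = (x - y) + (z - w) + (y + w - v).
    by rewrite [x - y + (z - w)]addrACA -opprD addrA subrK.
  apply: le_lt_trans (ler_normD _ _) _.
  have := ler_normD (x - y) (z - w).
  have : C' * (3 * (J%:R * e1 + W * e1) / k) = C' * (3 * (J%:R + W) / k) * e1 by ring.
  move: e1M H2; rewrite /M => + H2 E; rewrite E in H2; nra.
Unshelve. all: by end_near. Qed.

End Tracking.

(** * One sequence of time changes for all precisions and horizons *)

(** For each [l] take a time change for the largest achievable index [k] at most [l], or the
    identity if there is none; monotonicity gives the smaller indices. *)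
Lemma diagonal_time_change (R : realType) (P : nat -> nat -> (R -> R) -> Prop) :
  (forall k m l lam, (k <= m)%N -> P m l lam -> P k l lam) ->
  (forall k, \forall l \near \oo, exists2 lam, time_change lam & P k l lam) ->
  exists2 lam_ : nat -> R -> R, forall l, time_change (lam_ l) &
    forall k, \forall l \near \oo, P k l (lam_ l).
Proof.
move=> Pmono Pex.
have best l : exists lam : R -> R, time_change lam /\ forall k, (k <= l)%N ->
    (exists2 lam', time_change lam' & P k l lam') -> P k l lam.
  suff H m : exists lam : R -> R, time_change lam /\ forall k, (k < m)%N ->
      (exists2 lam', time_change lam' & P k l lam') -> P k l lam.
    by have [lam [tc H']] := H l.+1; exists lam.
  elim: m => [|m [lam [tc IH]]].
    exists id; split => //; split => //; split => //.
    by move=> y y0; exists y.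
  have [[lam' tc' Pm]|nP] := pselect (exists2 lam', time_change lam' & P m l lam').
    by exists lam'; split => // k km _; exact: Pmono Pm.
  exists lam; split => // k; rewrite ltnS leq_eqVlt => /orP[/eqP ->//|/IH]; exact.
have [lam_ H] := choice best.
exists lam_ => [l|k]; first by have [] := H l.
near=> l; have [_] := H l; apply; first by near: l; exact: nbhs_infty_ge.
by near: l; exact: Pex.
Unshelve. all: by end_near. Qed.

Theorem theorem6p15 (R : realType) (J N M : nat)
    (hJ : (0 < J)%N) (hN : (0 < N)%N) (hM : (0 < M)%N)
    (U : set 'rV[R]_M) (hU : open U)
    (n : 'I_N -> 'rV[R]_J) (hn : forall i, enorm (n i) = 1)
    (c : 'I_N -> R)
    (d : 'I_N -> 'rV[R]_M -> 'rV[R]_J)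
    (hdC1 : forall i, C1_on U (d i))
    (hdn : forall i a, U a -> dot (d i a) (n i) = 1)
    (hA2 : forall a, U a -> assumption_A2 n (d ^~ a))
    (hA3 : forall a, U a -> assumption_A3 n c (d ^~ a))
    (alpha : 'rV[R]_M) (halpha : U alpha)
    (f h g : R -> 'rV[R]_J)
    (hf : cpath f) (hf0 : polyhedron n c (f 0))
    (hESP : solves_ESP n c (d ^~ alpha) f h g)
    (hjitter : boundary_jitter n c h g)
    (f_ h_ g_ : nat -> R -> 'rV[R]_J)
    (hf_ : forall l, cadlag (f_ l)) (hf_0 : forall l, polyhedron n c (f_ l 0))
    (hfcvg : J1_cvg f_ f)
    (hESP_ : forall l, solves_ESP n c (d ^~ alpha) (f_ l) (h_ l) (g_ l))
    (psi : R -> 'rV[R]_J) (hpsi : cpath psi)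
    (hpsi0 : active_hyperplanes n c (h 0) (psi 0))
    (psi_ : nat -> R -> 'rV[R]_J) (hpsi_ : forall l, cadlag (psi_ l))
    (hpsicvg : J1_cvg psi_ psi)
    (phi : R -> 'rV[R]_J)
    (hphi : derivative_map n c (d ^~ alpha) h psi phi)
    (phi_ : nat -> R -> 'rV[R]_J)
    (hphi_ : forall l,
      derivative_map n c (d ^~ alpha) (h_ l) (psi_ l) (phi_ l)) :
  J1_cvg phi_ phi.
Proof.
have dn i : dot (d i alpha) (n i) = 1 by exact: hdn.
have A2 := hA2 _ halpha.
have fl := J1_cvg_continuous_limit hf hfcvg.
have psil := J1_cvg_continuous_limit hpsi hpsicvg.
have gl := ESP_locally_uniform hn dn A2 hESP hESP_ fl.
have hl : locally_uniform h_ h.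
  move=> T e e0; have e2 : 0 < e / 2 by lra.
  have [_ [hE _ _ _]] := hESP.
  near=> l; have [_ [hlE _ _ _]] := hESP_ l.
  have Hf : forall t, 0 <= t -> t <= T -> `|f_ l t - f t| < e / 2 by near: l; exact: fl.
  have Hg : forall t, 0 <= t -> t <= T -> `|g_ l t - g t| < e / 2 by near: l; exact: gl.
  move=> t t0 tT; rewrite hE// hlE// opprD addrACA.
  apply: le_lt_trans (ler_normD _ _) _; have := Hf t t0 tT; have := Hg t t0 tT; lra.
have [eta D _] := hphi.
have /choice[eta_ D_] : forall l, exists eta,
    solves_derivative_problem n c (d ^~ alpha) (h_ l) (psi_ l) (phi_ l) eta.
  by move=> l; have [eta' D' _] := hphi_ l; exists eta'.
(* The index [k] sets both the precision and the horizon, since one sequence must serve every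
   [T]. *)
pose P k l (lam : R -> R) := (forall t, 0 <= t -> `|lam t - t| < k.+1%:R^-1) /\
  forall t, 0 <= t -> t <= k%:R -> `|phi_ l (lam t) - phi t| < k.+1%:R^-1.
have [||lam_ tc lamP] := @diagonal_time_change R P.
- move=> k m l lam km [P1 P2].
  have mk : m.+1%:R^-1 <= k.+1%:R^-1 :> R by rewrite lef_pV2 ?posrE// ler_nat.
  split => [t t0|t t0 tk]; first by apply: lt_le_trans (P1 t t0) mk.
  by apply: lt_le_trans (P2 t t0 _) mk; rewrite (le_trans tk)// ler_nat.
- move=> k; have k0 : 0 < k.+1%:R^-1 :> R by rewrite invr_gt0.
  have H := derivative_tracking hn dn A2 hjitter hpsi hpsi0 D hESP_ hl gl D_ psil
    k%:R k0.
  by apply: filterS H => l [lam [H1 H2 H3]]; exists lam.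
have big_k (T e : R) : 0 < e -> exists k : nat, T <= k%:R /\ k.+1%:R^-1 < e.
  move=> e0; apply: (@filter_ex _ \oo); near=> k; split.
    by near: k; exact: nbhs_infty_ger.
  by near: k; exact: near_infty_natSinv_lt (PosNum e0).
exists lam_; split => // [|T]; apply/uniform_cvgP => e e0.
  have [k [_ ke]] := big_k 0 e e0.
  apply: filterS (lamP k) => l [H _] t; rewrite /= in_itv/= andbT => t0.
  exact: lt_trans (H t t0) ke.
have [k [Tk ke]] := big_k T e e0.
apply: filterS (lamP k) => l [_ H] t; rewrite /= in_itv/= => /andP[t0 tT].
exact: lt_trans (H t t0 (le_trans tT Tk)) ke.
Unshelve. all: by end_near. Qed.
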